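(* Fix $\lambda>0$ and $\alpha\in[0,1)$. For each $n\ge1$ let $K_{\alpha,\lambda n,n}$ be the number of parts of a random partition of $\{1,\dots,n\}$ drawn from the Ewens--Pitman model with parameters $\alpha$ and $\theta=\lambda n$, and let $F_n$ be the cumulative distribution function of $$\frac{\sqrt n}{\mathfrak{s}_{\lambda,\alpha}}\left(\frac{K_{\alpha,\lambda n,n}}{n}-\mathfrak{m}_{\lambda,\alpha}\right).$$ Then, for any $\epsilon\in(0,1)$, there exist constants $C_1=C_1(\lambda,\alpha,\epsilon)$ and $C_2=C_2(\lambda)$ such that, for all $n$, $$\sup_{x\in\mathbb{R}}|F_n(x)-\Phi(x)|\le\begin{cases}C_1\,n^{-1/5+2\epsilon/5}, & \alpha\in(0,1),\\ C_2\,n^{-1/2}, & \alpha=0,\end{cases}$$ where $\Phi$ is the cumulative distribution function of the standard normal law. In particular, $$\frac{\sqrt n}{\mathfrak{s}_{\lambda,\alpha}}\left(\frac{K_{\alpha,\lambda n,n}}{n}-\mathfrak{m}_{\lambda,\alpha}\right)\xrightarrow{d}\mathcal{N}(0,1)\quad\text{as } n\to\infty.$$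
   Context: Constants: $$\mathfrak{m}_{\lambda,\alpha}=\begin{cases}\frac{\lambda}{\alpha}\left[\left(1+\frac1\lambda\right)^{\alpha}-1\right], & \alpha\in(0,1),\\ \lambda\log\left(1+\frac1\lambda\right), & \alpha=0,\end{cases}$$ and $\mathfrak{s}_{\lambda,\alpha}>0$ is the positive square root of $$\mathfrak{s}_{\lambda,\alpha}^2=\begin{cases}\frac{\lambda}{\alpha}\left[\left(1+\frac1\lambda\right)^{2\alpha}\left(1-\frac{\alpha}{1+\lambda}\right)-\left(1+\frac1\lambda\right)^{\alpha}\right], & \alpha\in(0,1),\\ \lambda\log\left(1+\frac1\lambda\right)-\frac{\lambda}{1+\lambda}, & \alpha=0.\end{cases}$$ Ewens--Pitman model: for $\alpha\in[0,1)$ and $\theta>0$ (here $\theta=\lambda n$), a random partition of $\{1,\dots,n\}$ with $K_n$ parts of sizes $N_n=(N_1,\dots,N_{K_n})$ (parts listed in exchangeable order) has law $$P\big(K_n=k,\,N_n=(n_1,\dots,n_k)\big)=\frac1{k!}\binom{n}{n_1,\dots,n_k}\frac{[\theta]_{k,\alpha}}{[\theta]_{n,1}}\prod_{i=1}^k[1-\alpha]_{n_i-1,1},$$ for positive integers $n_1,\dots,n_k$ with sum $n$, where $[x]_{m,a}=x(x+a)\cdots(x+(m-1)a)$ (with $[x]_{0,a}=1$) is the rising factorial of order $m$ and increment $a$. Equivalently (Generalized Chinese Restaurant construction), the number of parts $K_{\alpha,\theta,n}$ has the law of the number of occupied tables after $n$ customers, where customer 1 opens a table and, given that $m-1\ge1$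 customers occupy $k$ tables with $n_i$ customers at table $i$, customer $m$ joins table $i$ with probability $\frac{n_i-\alpha}{\theta+m-1}$ and opens a new table with probability $\frac{\theta+\alpha k}{\theta+m-1}$. *)

(* Defs.v *)
From HB Require Import structures.
From mathcomp Require Import all_boot all_order all_algebra.
From mathcomp Require Import all_classical all_reals all_analysis.

Set Implicit Arguments.
Unset Strict Implicit.
Unset Printing Implicit Defensive.

Import Order.TTheory GRing.Theory Num.Theory.
Import numFieldNormedType.Exports.

Local Open Scope classical_set_scope.
Local Open Scope ring_scope.

(* [x]_{m,a} = x (x + a) ... (x + (m - 1) a) *)
Definition rising (R : realType) (x : R) (m : nat) (a : R) : R :=
  \prod_(i < m) (x + i%:R * a).

Definition mean_const (R : realType) (lambda alpha : R) : R :=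
  if alpha == 0 then lambda * ln (1 + lambda^-1)
  else lambda / alpha * ((1 + lambda^-1) `^ alpha - 1).

Definition var_const (R : realType) (lambda alpha : R) : R :=
  if alpha == 0 then lambda * ln (1 + lambda^-1) - lambda / (1 + lambda)
  else lambda / alpha *
    ((1 + lambda^-1) `^ (2 * alpha) * (1 - alpha / (1 + lambda))
     - (1 + lambda^-1) `^ alpha).

Definition sd_const (R : realType) (lambda alpha : R) : R :=
  Num.sqrt (var_const lambda alpha).

HB.instance Definition _ := isPointed.Build (seq nat) [::].
HB.instance Definition _ := @isMeasurable.Build default_measure_display
  (seq nat) (@discrete_measurable (seq nat))
  (@discrete_measurable0 _) (@discrete_measurableC _) (@discrete_measurableU _).

HB.instance Definition _ (I : finType) := isPointed.Build {set I} (@finset.set0 I).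
HB.instance Definition _ (I : finType) :=
  @isMeasurable.Build default_measure_display
  {set I} (@discrete_measurable {set I})
  (@discrete_measurable0 _) (@discrete_measurableC _) (@discrete_measurableU _).

(* Law of the list [s = (n_1, ..., n_k)] of part sizes, with [k = size s]. *)
Definition ewens_pitman_pmf (R : realType) (n : nat) (alpha theta : R)
    (s : seq nat) : R :=
  ((size s)`!%:R)^-1
  * (n`!%:R / \prod_(m <- s) m`!%:R)
  * (rising theta (size s) alpha / rising theta n 1)
  * \prod_(m <- s) rising (1 - alpha) m.-1 1.

(* [N] lists the part sizes of the random set partition [Pi], whose number of
   parts is [#|Pi t|].  The prescribed weight is symmetric in the entries of [s],
   which encodes that the parts are listed in exchangeable order. *)
Definition ewens_pitman (R : realType) (n : nat) (alpha theta : R)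
    (d : measure_display) (T : measurableType d) (P : probability T R)
    (Pi : {RV P >-> {set {set 'I_n}}}) (N : {RV P >-> seq nat}) : Prop :=
  [/\ forall t, finset.partition (Pi t) (finset.setTfor 'I_n),
      forall t, perm_eq (N t) [seq #|B : {set 'I_n}| | B <- enum (Pi t)]
    & forall s : seq nat, all (leq 1) s -> sumn s = n ->
        P [set t | #|Pi t| = size s /\ N t = s]
        = (ewens_pitman_pmf n alpha theta s)%:E].

Section standardized_parts.
Context (R : realType) (lambda alpha : R) (n : nat).
Context (d : measure_display) (T : measurableType d) (P : probability T R).
Variable Pi : {RV P >-> {set {set 'I_n}}}.

Definition standardized_parts (t : T) : R :=
  Num.sqrt n%:R / sd_const lambda alpha
  * (#|Pi t|%:R / n%:R - mean_const lambda alpha).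

Let measurable_standardized_parts :
  measurable_fun [set: T] standardized_parts.
Proof.
apply: (@measurableT_comp _ _ _ _ _ _ (fun p : {set {set 'I_n}} =>
  Num.sqrt n%:R / sd_const lambda alpha
  * (#|p|%:R / n%:R - mean_const lambda alpha)) _ Pi) => //.
Qed.

HB.instance Definition _ := isMeasurableFun.Build _ _ T R
  standardized_parts measurable_standardized_parts.

End standardized_parts.

(* Pointwise convergence of cdfs at the continuity points of the limit cdf; the
   random variables may live on different probability spaces. *)
Definition cvg_in_distribution (R : realType) (d : nat -> measure_display)
    (T : forall n, measurableType (d n)) (P : forall n, probability (T n) R)
    (X : forall n, {RV (P n) >-> R})
    (mu : probability (measurableTypeR R) R) : Prop :=
  forall x : R, {for x, continuous (fun y : R => mu `]-oo, y]%classic)} ->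
    cdf (X n) x @[n --> \oo] --> mu `]-oo, x]%classic.

(* Main.v *)
Require Import Defs.
From HB Require Import structures.
From mathcomp Require Import all_boot all_order all_algebra.
From mathcomp Require Import all_classical all_reals all_analysis.
From mathcomp Require Import ring lra zify.
Import Order.TTheory GRing.Theory Num.Theory.
Import numFieldNormedType.Exports.
Local Open Scope classical_set_scope.
Local Open Scope ring_scope.

Set Implicit Arguments.
Unset Strict Implicit.
Unset Printing Implicit Defensive.

(** Let K_m be the number of occupied tables after m customers of the Chinese
    restaurant with parameters alpha and theta = lambda n.  It is a Markov chain
    that moves from k to k + 1 at time m with probability
    p_m(k) = (theta + alpha k) / (theta + m), and [run alpha theta 0 n g 0] is
    the expectation of g(K_n).  The number of parts of an Ewens--Pitman
    partition has the law of K_n because the generating function W of the block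
    weights satisfies (1 - x) W' = 1 - alpha W ([block_poly_rec], [parts_run]).

    The normal approximation is an instance of Stein's method.  Since p_m is
    affine in k, a finite difference passes through a transition of the chain at
    the price of a factor c_m = 1 + alpha / (theta + m) and of the replacement
    of theta by theta + alpha ([fdiff_step]).  The martingale decomposition of
    K_n - E K_n then unrolls into the exact formula ([cov_tablesE])
      E[(K_n - E K_n) g(K_n)] = sum_i A_i E[p_i (1 - p_i)(K_i) Dg(K^(i))],
    where Dg is the finite difference of g, A_i is the square of a product of
    factors c_j, and K^(i) is the spliced chain: it follows the parameter theta
    until time i, skips one transition, and follows theta + alpha afterwards.
    Two estimates turn this into a zero-bias identity with a small error.
    First, K_i has fluctuations of order n^(1/2), so p_i (1 - p_i)(K_i) is
    within O(n^(-1/2)) of its mean ([cov_tables_spliced]).  Second, the transition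
    probabilities for theta and theta + alpha differ by at most 1 / theta, so
    K^(i) and K_n are at bounded Wasserstein distance ([spliced_close]).

    Let Phi and phi be the normal distribution function and density.  The Stein
    equation f'(w) - w f(w) = 1(w <= z) - Phi(z) has the explicit solution
    (1 - Phi(z)) Phi(w) / phi(w) for w <= z and Phi(z) (1 - Phi(w)) / phi(w) for
    w >= z; Mills' inequality bounds f, f' and w f(w).  If z belongs to the
    lattice of values of the standardized K_n, no step of the lattice crosses
    the jump of f', so the mean value theorem applies to each step.  The result
    is that the weighted average over i of P(K^(i) < k) is within O(n^(-1/2)) of
    Phi at the k-th lattice point ([lattice_bound]).

    It remains to return from K^(i) to K_n.  If alpha = 0, the spliced chain is
    the original one with one transition removed; the two counts differ by at
    most one, which costs one lattice step, O(n^(-1/2)) ([kolmogorov_alpha0]).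
    If alpha > 0, the bounded Wasserstein distance is used through a ramp of L
    lattice steps in place of the indicator; the error is L n^(-1/2) + 1 / L up
    to constants, that is n^(-1/4) for L of order n^(1/4)
    ([kolmogorov_smooth]).  This is smaller than n^(-1/5 + 2 eps / 5).

    The mean and the variance of K_n are explicit products or sums, equal to
    n m + O(1) and n s^2 + O(1) ([moments_bounded]).  The Stein argument is run
    directly with the centring n m and the scale s sqrt(n), so that these O(1)
    terms are absorbed in its error.  Finally s^2 > 0 follows from the
    strict tangent inequality for the logarithm ([var_const_gt0]). *)

(** * The chain of table counts and its covariance identity *)

Section chain.
Variables (R : realType) (alpha : R).
Implicit Types (theta c x y : R) (m l k : nat) (g h V : nat -> R).

(** The probability that customer m + 1 opens a new table when x tables are
    occupied.  The argument is real so that it can be evaluated at a mean. *)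
Definition new_table theta m x : R := (theta + alpha * x) / (theta + m%:R).

Definition step theta m g : nat -> R := fun k =>
  new_table theta m k%:R * g k.+1 + (1 - new_table theta m k%:R) * g k.

(** The expectation of g at time m + l for the chain started from k at time m;
    the composition of l transitions, the first one outermost. *)
Fixpoint run theta m l g : nat -> R :=
  if l is l'.+1 then step theta m (run theta m.+1 l' g) else g.

Definition fdiff g : nat -> R := fun k => g k.+1 - g k.

Lemma runS_r theta m l g : run theta m l.+1 g = run theta m l (step theta (m + l) g).
Proof.
elim: l m => [|l IH] m; first by rewrite /= addn0.
by rewrite [LHS]/= -/(run theta m.+1 l.+1 g) IH addSnnS.
Qed.

Lemma run_add theta m l1 l2 g :
  run theta m (l1 + l2) g = run theta m l1 (run theta (m + l1) l2 g).
Proof.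
elim: l1 m => [|l IH] m /=; first by rewrite addn0.
by rewrite IH addSnnS.
Qed.

Lemma run_cst theta m l c : run theta m l (fun=> c) = fun=> c.
Proof.
elim: l m => [//|l IH] m /=; rewrite IH; apply/funext => k.
by rewrite /step; ring.
Qed.

Lemma runD theta m l g h :
  run theta m l (g \+ h) = run theta m l g \+ run theta m l h.
Proof.
elim: l m => [//|l IH] m /=; rewrite IH; apply/funext => k.
by rewrite /step /=; ring.
Qed.

Lemma runZ theta m l c g : run theta m l (c \*o g) = c \*o run theta m l g.
Proof.
elim: l m => [//|l IH] m /=; rewrite IH; apply/funext => k.
by rewrite /step /=; ring.
Qed.

Lemma runB theta m l g h :
  run theta m l (g \- h) = run theta m l g \- run theta m l h.
Proof.
elim: l m => [//|l IH] m /=; rewrite IH; apply/funext => k.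
by rewrite /step /=; ring.
Qed.

Hypothesis alpha01 : 0 <= alpha < 1.

Lemma new_table_itv theta m x : 0 < theta -> 0 <= x <= m%:R ->
  0 <= new_table theta m x <= 1.
Proof.
move=> t0 /andP[x0 xm]; case/andP: alpha01 => a0 a1.
have tm : 0 < theta + m%:R by lra.
have ak0 : 0 <= alpha * x by rewrite mulr_ge0.
have akm : alpha * x <= x by rewrite ler_piMl // ltW.
apply/andP; split; first by apply: divr_ge0; lra.
by rewrite ler_pdivrMr // mul1r; lra.
Qed.

Lemma new_table01 theta m k : 0 < theta -> (k <= m)%N ->
  0 <= new_table theta m k%:R <= 1.
Proof. by move=> t0 km; rewrite new_table_itv // ler0n ler_nat. Qed.

Lemma step_mono theta m g h k : 0 < theta ->
  (forall j, (j <= m.+1)%N -> g j <= h j) -> (k <= m)%N ->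
  step theta m g k <= step theta m h k.
Proof.
move=> t0 gh km; have /andP[p0 p1] := new_table01 t0 km.
have := gh k (leqW km); have := gh k.+1 km.
by rewrite /step; nra.
Qed.

Lemma run_mono theta m l g h k : 0 < theta ->
  (forall j, (j <= m + l)%N -> g j <= h j) -> (k <= m)%N ->
  run theta m l g k <= run theta m l h k.
Proof.
move=> t0; elim: l m k => [|l IH] m k gh km /=; first by apply: gh; rewrite addn0.
by apply: step_mono => // j jm; apply: IH => // i; rewrite addSnnS; exact: gh.
Qed.

Lemma run_ge_cst theta m l c g k : 0 < theta ->
  (forall j, (j <= m + l)%N -> c <= g j) -> (k <= m)%N -> c <= run theta m l g k.
Proof.
move=> t0 cg km; rewrite -[leLHS]/((fun=> c) k) -(run_cst theta m l c).
exact: run_mono.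
Qed.

Lemma run_le_cst theta m l c g k : 0 < theta ->
  (forall j, (j <= m + l)%N -> g j <= c) -> (k <= m)%N -> run theta m l g k <= c.
Proof.
move=> t0 gc km; rewrite -[leRHS]/((fun=> c) k) -(run_cst theta m l c).
exact: run_mono.
Qed.

Lemma run_ge0 theta m l g k : 0 < theta ->
  (forall j, 0 <= g j) -> (k <= m)%N -> 0 <= run theta m l g k.
Proof. by move=> t0 g0 km; exact: run_ge_cst. Qed.

Lemma run_abs theta m l g h k : 0 < theta ->
  (forall j, (j <= m + l)%N -> `|g j| <= h j) -> (k <= m)%N ->
  `|run theta m l g k| <= run theta m l h k.
Proof.
move=> t0 gh km; rewrite ler_norml; apply/andP; split.
  have := @run_mono theta m l (-1 \*o h) g k t0 _ km.
  rewrite runZ /= mulN1r; apply=> j /gh.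
  by rewrite ler_norml mulN1r => /andP[].
by apply: run_mono => // j /gh; rewrite ler_norml => /andP[].
Qed.

Definition growth theta m : R := 1 + alpha / (theta + m%:R).

Definition growths theta m l : R := \prod_(i < l) growth theta (m + i).

Lemma growths0 theta m : growths theta m 0 = 1.
Proof. exact: big_ord0. Qed.

Lemma growthsS_r theta m l :
  growths theta m l.+1 = growths theta m l * growth theta (m + l).
Proof. by rewrite /growths big_ord_recr. Qed.

Lemma thetaDn_gt0 theta m : 0 < theta -> 0 < theta + m%:R.
Proof. by move=> t0; rewrite ltr_wpDr. Qed.

(** The key algebraic fact: the probabilities of moving from k + 1 and of staying
    at k add up to [growth theta m], and once normalized by it they are the
    transition probabilities of the chain with parameter theta + alpha. *)
Lemma fdiff_step theta m g : 0 < theta ->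
  fdiff (step theta m g) = growth theta m \*o step (theta + alpha) m (fdiff g).
Proof.
move=> t0; apply/funext => k; rewrite /fdiff /step /growth /new_table /=.
have tm := thetaDn_gt0 m t0; case/andP: alpha01 => a0 a1.
have tma : theta + alpha + m%:R != 0 by rewrite gt_eqF//; lra.
by rewrite -natr1; field; rewrite tma gt_eqF.
Qed.

Lemma stepZ theta m c g : step theta m (c \*o g) = c \*o step theta m g.
Proof. exact: (@runZ theta m 1). Qed.

Lemma fdiff_run theta m l g : 0 < theta ->
  fdiff (run theta m l g) = growths theta m l \*o run (theta + alpha) m l (fdiff g).
Proof.
move=> t0; elim: l m => [|l IH] m /=.
  by apply/funext => k; rewrite /growths big_ord0 /= mul1r.
rewrite fdiff_step // IH stepZ /growths big_ord_recl addn0; apply/funext => k /=.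
rewrite mulrA; congr (_ * _ * _); apply: eq_bigr => i _.
by rewrite /bump /= add1n addSnnS.
Qed.

Definition mean_tables theta m : R := run theta 0 m (fun k => k%:R) 0.

Lemma mean_tables_rec theta m :
  mean_tables theta m.+1 = mean_tables theta m + new_table theta m (mean_tables theta m).
Proof.
rewrite {1}/mean_tables runS_r add0n.
pose t := (theta + m%:R)^-1.
have -> : step theta m (fun k => k%:R) =
  (1 + alpha * t) \*o (fun k => k%:R) \+ (fun=> theta * t).
  by apply/funext => k; rewrite /step /new_table -/t /= -natr1; ring.
by rewrite runD runZ run_cst /= -/(mean_tables theta m) /new_table -/t; ring.
Qed.

Definition step_var theta m x := new_table theta m x * (1 - new_table theta m x).

Definition cov_tables theta m g : R := run theta 0 m (fun k => (k%:R - mean_tables theta m) * g k) 0.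

(** With x = K_m and xi the increment, K_(m+1) - E K_(m+1) is
    [growth theta m] times the centred count at time m plus the martingale increment
    xi - p(x).  The latter, multiplied by g(x + xi), has conditional expectation
    p(1 - p) times the difference of g. *)
Lemma cov_tables_rec theta m g :
  cov_tables theta m.+1 g = run theta 0 m (fun k => step_var theta m k%:R * fdiff g k) 0
   + growth theta m * cov_tables theta m (step theta m g).
Proof.
rewrite /cov_tables runS_r add0n -[growth _ _ * _]/((growth theta m \*o run theta 0 m _) 0).
rewrite -runZ -[_ + _]/((run theta 0 m _ \+ run theta 0 m _) 0) -runD.
congr (run theta 0 m _ 0); apply/funext => k /=.
rewrite mean_tables_rec /step_var /fdiff /step /growth /new_table -natr1; ring.
Qed.

(** One factor [growths] comes from unrolling [cov_tables_rec], the other one from moving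
    the finite difference through the remaining transitions. *)
Lemma cov_tablesE theta n g : 0 < theta ->
  cov_tables theta n g = \sum_(i < n) growths theta i.+1 (n - i.+1) ^+ 2 *
    run theta 0 i (fun k => step_var theta i k%:R *
       run (theta + alpha) i.+1 (n - i.+1) (fdiff g) k) 0.
Proof.
move=> t0; elim: n g => [|n IH] g.
  by rewrite big_ord0 /cov_tables /mean_tables /= subrr mul0r.
rewrite cov_tables_rec IH big_ord_recr /= subnn growths0 expr1n mul1r addrC.
congr (_ + _); rewrite mulr_sumr; apply: eq_bigr => -[i /= ltin] _.
have -> : (n.+1 - i.+1 = (n - i.+1).+1)%N by rewrite subSS subnSK.
rewrite fdiff_step // runZ growthsS_r runS_r subnKC //.
set h := run (theta + alpha) i.+1 _ _.
have -> : (fun k => step_var theta i k%:R * (growth theta n \*o h) k) =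
   growth theta n \*o (fun k => step_var theta i k%:R * h k).
  by apply/funext => k /=; ring.
by rewrite runZ /=; ring.
Qed.

Lemma step_affine theta m c L h :
  step theta m (fun k => c * (h k + L)) = fun k => c * (step theta m h k + L).
Proof. by apply/funext => k; rewrite /step; ring. Qed.

Lemma run_affine theta m l c L h k :
  run theta m l (fun k => c * h k + L) k = c * run theta m l h k + L.
Proof. by rewrite [X in run _ _ _ X](_ : _ = (c \*o h) \+ (fun=> L)) // runD runZ run_cst. Qed.

End chain.

(** * Comparison of chains with neighbouring parameters *)

Section comparison.
Variables (R : realType) (alpha theta r : R) (N : nat).
Hypotheses (alpha01 : 0 <= alpha < 1) (theta0 : 0 < theta)
  (rN : N%:R <= r * theta).
Local Notation step := (step alpha).
Local Notation run := (run alpha).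
Local Notation growth := (growth alpha).
Local Notation growths := (growths alpha).
Local Notation new_table := (new_table alpha).
Implicit Types (g h V : nat -> R).
Let theta' := theta + alpha.
Let E := expR r.

Let a0 : 0 <= alpha. Proof. by case/andP: alpha01. Qed.
Let a1 : alpha < 1. Proof. by case/andP: alpha01. Qed.
Let theta'0 : 0 < theta'. Proof. by rewrite /theta'; have := a0; have := theta0; lra. Qed.
Let r0 : 0 <= r.
Proof. by rewrite -(pmulr_lge0 _ theta0); apply: le_trans rN. Qed.
Let E0 : 0 <= E. Proof. exact: expR_ge0. Qed.

Lemma invDn_le m : (theta + m%:R)^-1 <= theta^-1.
Proof. by rewrite lef_pV2 ?posrE ?thetaDn_gt0// lerDl. Qed.

Lemma growth_ge1 m : 1 <= growth theta m.
Proof. by rewrite /growth lerDl divr_ge0// ltW// thetaDn_gt0. Qed.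

Lemma growths_ge1 m l : 1 <= growths theta m l.
Proof.
elim: l => [|l IH]; first by rewrite growths0.
by rewrite growthsS_r mulr_ege1 // growth_ge1.
Qed.

Lemma lerN_div l : (l <= N)%N -> l%:R / theta <= r.
Proof.
move=> lN; rewrite ler_pdivrMr //; apply: le_trans rN.
by rewrite ler_nat.
Qed.

(** There are at most N factors, each at most exp(1 / theta). *)
Lemma growths_le m l : (l <= N)%N -> growths theta m l <= E.
Proof.
move=> lN; apply: (@le_trans _ _ (\prod_(i < l) expR theta^-1)).
  apply: ler_prod => i _; rewrite (le_trans ler01 (growth_ge1 _)) /=.
  apply: le_trans (expR_ge1Dx _); rewrite lerD2l.
  apply: le_trans (invDn_le (m + i)).
  by rewrite ler_piMl ?ltW // invr_gt0 thetaDn_gt0.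
by rewrite prodr_const card_ord -expRM_natl ler_expR lerN_div.
Qed.

Lemma fdiff_run_le m l g V k : (l <= N)%N -> (k <= m)%N ->
  (forall j, `|fdiff g j| <= V j) ->
  `|fdiff (run theta m l g) k| <= E * run theta' m l V k.
Proof.
move=> lN km gV; rewrite fdiff_run //= normrM.
have H := @run_abs _ _ alpha01 theta' m l _ V k theta'0 (fun j _ => gV j) km.
rewrite ler_pM // ger0_norm ?growths_le //.
exact: le_trans (growths_ge1 _ _).
Qed.

Lemma step_shift th m h k :
  step th m h k = h k + new_table th m k%:R * fdiff h k.
Proof. by rewrite /step /fdiff; ring. Qed.

(** One transition moves the count by at most one, so skipping it costs a finite
    difference of what follows. *)
Lemma run_skip m l g V k : (l <= N)%N -> (k <= m)%N ->
  (forall j, `|fdiff g j| <= V j) ->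
  `|run theta m.+1 l g k - run theta m l.+1 g k| <= E * run theta' m.+1 l V k.
Proof.
move=> lN km gV; rewrite /= step_shift opprD addrA subrr sub0r normrN normrM.
apply: le_trans (fdiff_run_le lN (leqW km) gV).
have /andP[p0 p1] := new_table01 alpha01 theta0 km.
by rewrite ger0_norm // ler_piMl.
Qed.

(** The difference is
    alpha (m - alpha k) / ((theta + m) (theta + alpha + m)), and k <= m. *)
Lemma new_table_shift m k : (k <= m)%N ->
  `|new_table theta' m k%:R - new_table theta m k%:R| <= theta^-1.
Proof.
move=> km; have tm := thetaDn_gt0 m theta0; have tm' := thetaDn_gt0 m theta'0.
have kmR : k%:R <= m%:R :> R by rewrite ler_nat.
have ak0 : 0 <= alpha * k%:R by rewrite mulr_ge0.
have akm : alpha * k%:R <= k%:R by rewrite ler_piMl // ltW.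
have -> : new_table theta' m k%:R - new_table theta m k%:R =
  alpha * ((m%:R - alpha * k%:R) / (theta' + m%:R)) / (theta + m%:R).
  rewrite /new_table /theta'; field.
  by rewrite (gt_eqF tm) gt_eqF.
have m0 : 0 <= m%:R :> R by [].
have t1 : 0 <= (m%:R - alpha * k%:R) / (theta' + m%:R) <= 1.
  apply/andP; split; first by apply: divr_ge0; [lra|exact: ltW].
  by rewrite ler_pdivrMr // mul1r; have := theta'0; lra.
case/andP: t1 => t10 t11.
rewrite ger0_norm; last by apply: divr_ge0; [exact: mulr_ge0|exact: ltW].
apply: le_trans (invDn_le m); rewrite ler_piMl ?invr_ge0 ?(ltW tm) //.
by rewrite mulr_ile1 // ltW.
Qed.

(** The first transition is replaced last: this is one step of the telescoping sum
    that exchanges the transitions one at a time. *)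
Lemma run_shift_rec m l g k :
  run theta' m l.+1 g k - run theta m l.+1 g k =
  step theta' m (run theta' m.+1 l g \- run theta m.+1 l g) k
  + (new_table theta' m k%:R - new_table theta m k%:R) * fdiff (run theta m.+1 l g) k.
Proof. by rewrite /= /step /fdiff /=; ring. Qed.

Lemma step_norm_le th m g h k : 0 < th -> (k <= m)%N ->
  (forall j, (j <= m.+1)%N -> `|g j| <= h j) -> `|step th m g k| <= step th m h k.
Proof.
move=> th0 km gh; apply: (@run_abs _ _ alpha01 th m 1 g h k th0) => // j.
by rewrite addn1; exact: gh.
Qed.

(** The case of constant V in [run_shift].  It is needed first, because it controls
    how the expectation of V itself changes with the parameter. *)
Lemma run_shift_lip m l g L k : (l <= N)%N -> (k <= m)%N ->
  (forall j, `|fdiff g j| <= L) ->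
  `|run theta' m l g k - run theta m l g k| <= l%:R / theta * E * L.
Proof.
move=> + + gL; elim: l m k => [|l IH] m k lN km.
  by rewrite /= subrr normr0 mul0r mul0r mul0r.
rewrite run_shift_rec (le_trans (ler_normD _ _)) //.
have -> : l.+1%:R / theta * E * L = l%:R / theta * E * L + theta^-1 * E * L.
  by rewrite -natr1; ring.
apply: lerD.
  rewrite -[leRHS](_ : step theta' m (fun=> l%:R / theta * E * L) k = _).
    by apply: step_norm_le => // j jm; apply: IH => //; exact: ltnW.
  by rewrite /step; ring.
rewrite normrM -mulrA ler_pM ?new_table_shift //.
by have := fdiff_run_le (ltnW lN) (leqW km) gL; rewrite run_cst.
Qed.

Let C2 := r * E + E.

Lemma run_shift_skip m l V L k : (l < N)%N -> (k <= m)%N -> 0 <= L ->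
  (forall j, `|fdiff V j| <= L) ->
  run theta' m.+1 l V k <= run theta m l.+1 V k + C2 * L.
Proof.
move=> lN km L0 VL.
have := run_shift_lip (ltnW lN) (leqW km) VL.
have := run_skip (ltnW lN) km VL; rewrite run_cst !ler_norml.
have : l%:R / theta * E * L <= r * E * L.
  by rewrite ler_wpM2r // ler_wpM2r // lerN_div // ltnW.
by rewrite /C2 => + /andP[_ +] /andP[_ +]; lra.
Qed.

(** The increments of g may grow with k; V dominates them and is itself
    Lipschitz, as is needed for k |-> k f(k) when f is a Stein solution.  At
    each exchanged transition the bound appears as the expectation of V along a
    chain using both parameters, which [run_shift_skip] and the Lipschitz bound on V
    bring back to the original chain. *)
Lemma run_shift m l g V L k : (l <= N)%N -> (k <= m)%N -> 0 <= L ->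
  (forall j, `|fdiff g j| <= V j) -> (forall j, `|fdiff V j| <= L) ->
  `|run theta' m l g k - run theta m l g k| <=
   l%:R / theta * E * (run theta m l V k + (l%:R / theta * E + C2) * L).
Proof.
move=> + + L0 gV VL; elim: l m k => [|l IH] m k lN km.
  by rewrite /= subrr normr0 mul0r mul0r mul0r.
have K0 : 0 <= theta^-1 * E by rewrite mulr_ge0 ?invr_ge0 // ltW.
have lK0 : 0 <= l%:R / theta * E by rewrite -mulrA mulr_ge0.
rewrite run_shift_rec (le_trans (ler_normD _ _)) //.
set K := theta^-1 * E; set e := run theta m l.+1 V k.
have V0 j : 0 <= V j by apply: le_trans (gV j).
have [eV eC0] : 0 <= e /\ 0 <= C2.
  by split; [exact: run_ge0 | rewrite /C2 addr_ge0 // mulr_ge0].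
apply: (@le_trans _ _ (l%:R * K * (e + K * L + (l%:R * K + C2) * L) + K * (e + C2 * L))).
  apply: lerD.
    apply: le_trans (_ : step theta' m
      (fun j => l%:R * K * (run theta m.+1 l V j + (l%:R * K + C2) * L)) k <= _).
      apply: step_norm_le => // j jm; rewrite /K !mulrA.
      by apply: IH => //; exact: ltnW.
    rewrite step_affine; apply: ler_wpM2l; first by rewrite mulr_ge0.
    rewrite lerD2r.
    rewrite -lerBlDl; apply: le_trans (ler_norm _) _.
    have -> : step theta' m (run theta m.+1 l V) k - e =
      (new_table theta' m k%:R - new_table theta m k%:R) * fdiff (run theta m.+1 l V) k.
      by rewrite /e /= /step /fdiff; ring.
    rewrite normrM -mulrA ler_pM ?new_table_shift //.
    by have := fdiff_run_le (ltnW lN) (leqW km) VL; rewrite run_cst.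
  rewrite normrM -mulrA ler_pM ?new_table_shift //.
  apply: le_trans (fdiff_run_le (ltnW lN) (leqW km) gV) _.
  rewrite ler_wpM2l //; exact: run_shift_skip.
have -> : l.+1%:R / theta * E = (l%:R + 1) * K by rewrite /K -natr1 mulrA.
have : 0 <= (l%:R + 1) * (K * L * K) by rewrite mulr_ge0 // mulr_ge0 // mulr_ge0.
by lra.
Qed.

(** The expectation of g(K^(m)) at time n, where the transition from time m to
    time m + 1 is skipped and theta + alpha is used afterwards. *)
Definition spliced n m g := run theta 0 m (run theta' m.+1 (n - m.+1) g) 0.

(** A bound in terms of r >= N / theta alone, and therefore uniform in n. *)
Definition spliced_cst := C2 + 2 * C2 ^+ 2.

(** The skipped transition costs [run_skip], the change of parameter costs
    [run_shift]. *)
Lemma spliced_close n m g V L : (m < n)%N -> (n <= N)%N -> 0 <= L ->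
  (forall j, `|fdiff g j| <= V j) -> (forall j, `|fdiff V j| <= L) ->
  `|spliced n m g - run theta 0 n g 0| <= spliced_cst * (run theta 0 n V 0 + L).
Proof.
move=> mn nN L0 gV VL; set l := (n - m.+1)%N.
have V0 j : 0 <= V j by apply: le_trans (gV j).
have nE : n = (m + l.+1)%N by rewrite /l; lia.
have lN : (l < N)%N by lia.
have C20 : 0 <= C2 by rewrite /C2 addr_ge0 // mulr_ge0.
have rE0 : 0 <= r * E by rewrite mulr_ge0.
have E2 : E <= C2 by rewrite /C2 lerDr.
have rE2 : r * E <= C2 by rewrite /C2 lerDl.
have run0n h : run theta 0 n h = run theta 0 m (run theta m l.+1 h).
  by rewrite [in LHS]nE run_add.
rewrite /spliced -/l !run0n.
have -> : run theta 0 m (run theta' m.+1 l g) 0 - run theta 0 m (run theta m l.+1 g) 0 =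
  run theta 0 m (run theta' m.+1 l g \- run theta m l.+1 g) 0 by rewrite runB.
apply: le_trans (_ : run theta 0 m (fun k => C2 * run theta m l.+1 V k + (2 * C2 ^+ 2) * L) 0 <= _); last first.
  rewrite run_affine /spliced_cst.
  have e0 : 0 <= run theta 0 m (run theta m l.+1 V) 0.
    by rewrite -run0n; exact: run_ge0.
  set e := run theta 0 m _ 0 in e0 *.
  have : 0 <= C2 ^+ 2 * e by rewrite mulr_ge0 // sqr_ge0.
  have : 0 <= C2 * L by rewrite mulr_ge0.
  nra.
apply: run_abs => // k; rewrite add0n => km /=.
have e0 : 0 <= run theta m l.+1 V k by exact: run_ge0.
rewrite -/(run theta m l.+1 g k) -/(run theta m l.+1 V k).
set e := run theta m l.+1 V k in e0 *.
have H1 := run_shift (ltnW lN) (leqW km) L0 gV VL.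
have H2 := run_skip (ltnW lN) km gV.
have H3 := run_shift_skip lN km L0 VL.
have /ler_normlW H4 := run_skip (ltnW lN) km VL; rewrite run_cst -/e in H4.
have H5 : run theta' m.+1 l V k <= e + C2 * L by [].
have lr := lerN_div (ltnW lN).
have lrE : l%:R / theta * E <= r * E by rewrite ler_wpM2r.
have lr0 : 0 <= l%:R / theta * E by rewrite mulr_ge0 // divr_ge0 // ltW.
have H1' : `|run theta' m.+1 l g k - run theta m.+1 l g k| <=
   r * E * (e + E * L + (r * E + C2) * L).
  apply: le_trans H1 _; apply: ler_pM => //.
    by rewrite addr_ge0 ?run_ge0 ?mulr_ge0 ?addr_ge0 // leqW.
  apply: lerD; first by lra.
  by rewrite ler_wpM2r // lerD2r.
have -> : run theta' m.+1 l g k - run theta m l.+1 g k =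
  (run theta' m.+1 l g k - run theta m.+1 l g k) + (run theta m.+1 l g k - run theta m l.+1 g k) by ring.
apply: le_trans (ler_normD _ _) _.
apply: le_trans (lerD H1' H2) _.
apply: le_trans (_ : r * E * (e + (E + r * E + C2) * L) + E * (e + C2 * L) <= _).
  apply: lerD; last by rewrite ler_wpM2l.
  by rewrite ler_wpM2l //; lra.
rewrite -[E + r * E](addrC (r * E)) -/C2.
have -> : r * E * (e + (C2 + C2) * L) + E * (e + C2 * L) =
  C2 * e + (C2 * (r * E) + C2 * C2) * L by rewrite /C2; ring.
rewrite lerD2l ler_wpM2r //.
have : C2 * (r * E) <= C2 * C2 by rewrite ler_wpM2l.
by rewrite expr2; lra.
Qed.

End comparison.

(** * Concentration, and the identity with deterministic weights *)

Section concentration.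
Variables (R : realType) (alpha theta r : R) (N : nat).
Hypotheses (alpha01 : 0 <= alpha < 1) (theta0 : 0 < theta)
  (rN : N%:R <= r * theta).
Local Notation step := (step alpha).
Local Notation run := (run alpha).
Local Notation growths := (growths alpha).
Local Notation new_table := (new_table alpha).
Local Notation mean_tables := (mean_tables alpha theta).
Local Notation step_var := (step_var alpha theta).
Local Notation cov_tables := (cov_tables alpha theta).
Local Notation spliced := (spliced alpha theta).
Implicit Types (g h V : nat -> R).
Let E := expR r.

Let a0 : 0 <= alpha. Proof. by case/andP: alpha01. Qed.
Let theta'0 : 0 < theta + alpha. Proof. by have := a0; have := theta0; lra. Qed.
Let r0 : 0 <= r.
Proof. by rewrite -(pmulr_lge0 _ theta0); apply: le_trans rN. Qed.
Let E0 : 0 <= E. Proof. exact: expR_ge0. Qed.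

Definition mean_step_var i := run theta 0 i (fun k => step_var i k%:R) 0.

Definition var_tables n : R := run theta 0 n (fun k => (k%:R - mean_tables n) ^+ 2) 0.

(** These weights add up to the variance ([var_tablesE]), as the case where g is
    the identity in [cov_tablesE] shows; divided by it they average over the skipped
    time. *)
Definition step_weight n i : R := growths theta i.+1 (n - i.+1) ^+ 2 * mean_step_var i.

Lemma step_var_ge0 i x : 0 <= x <= i%:R -> 0 <= step_var i x.
Proof.
move=> /(new_table_itv alpha01 theta0)/andP[p0 p1].
by rewrite /step_var mulr_ge0 // subr_ge0.
Qed.

Lemma step_var_le1 i x : step_var i x <= 1.
Proof. by rewrite /step_var; set p := new_table _ _ _; nra. Qed.

Lemma mean_step_var_itv i : 0 <= mean_step_var i <= 1.
Proof.
apply/andP; split.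
  by apply: run_ge_cst => // k ki; rewrite step_var_ge0 // ler0n ler_nat.
by apply: run_le_cst => // k ki; exact: step_var_le1.
Qed.

Lemma mean_tables_itv i : 0 <= mean_tables i <= i%:R.
Proof.
apply/andP; split; first exact: run_ge_cst.
by apply: run_le_cst => // k ki; rewrite ler_nat.
Qed.

Lemma run_centered n : run theta 0 n (fun k => k%:R - mean_tables n) 0 = 0.
Proof.
have -> : (fun k => k%:R - mean_tables n) = (fun k => k%:R) \- (fun=> mean_tables n) by [].
by rewrite runB run_cst /= subrr.
Qed.

Lemma cov_tables_addc n c g : cov_tables n (fun k => g k + c) = cov_tables n g.
Proof.
rewrite /cov_tables.
have -> : (fun k => (k%:R - mean_tables n) * (g k + c)) =
  (fun k => (k%:R - mean_tables n) * g k) \+ (c \*o (fun k => k%:R - mean_tables n)).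
  by apply/funext => k /=; ring.
by rewrite runD runZ /= run_centered mulr0 addr0.
Qed.

Lemma var_tablesE n : var_tables n = \sum_(i < n) step_weight n i.
Proof.
have -> : var_tables n = cov_tables n (fun k => k%:R).
  rewrite -(cov_tables_addc n (- mean_tables n)) /var_tables /cov_tables.
  by congr (run _ _ _ _ _); apply/funext => k; rewrite expr2.
rewrite cov_tablesE //; apply: eq_bigr => i _; rewrite /step_weight /mean_step_var.
congr (_ * run _ _ _ _ _); apply/funext => k.
rewrite [X in run _ _ _ X](_ : _ = fun=> 1) ?run_cst ?mulr1 //.
by apply/funext => j; rewrite /fdiff -natr1; ring.
Qed.

Lemma step_weight_ge0 n i : 0 <= step_weight n i.
Proof. by rewrite mulr_ge0 ?sqr_ge0 //; case/andP: (mean_step_var_itv i). Qed.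

Lemma growths_sq_le n i : (n <= N)%N -> 0 <= growths theta i.+1 (n - i.+1) ^+ 2 <= E ^+ 2.
Proof.
move=> nN; rewrite sqr_ge0 /= ler_pXn2r ?nnegrE //.
  by apply: (growths_le alpha01 theta0 rN); lia.
by apply: le_trans (growths_ge1 alpha01 theta0 _ _).
Qed.

Lemma var_tables_le n : (n <= N)%N -> var_tables n <= N%:R * E ^+ 2.
Proof.
move=> nN; rewrite var_tablesE.
apply: le_trans (_ : \sum_(i < n) E ^+ 2 <= _).
  apply: ler_sum => i _; have /andP[g0 gE] := growths_sq_le i nN.
  have /andP[m0 m1] := mean_step_var_itv i.
  by rewrite /step_weight -[leRHS]mulr1 ler_pM.
by rewrite sumr_const card_ord -[leLHS]mulr_natl ler_wpM2r ?sqr_ge0 // ler_nat.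
Qed.

Let S := Num.sqrt (N%:R : R).

(** By |x| <= x^2 / (2 s) + s / 2 with s of the order of the standard deviation. *)
Lemma abs_dev_le n : (0 < N)%N -> (n <= N)%N ->
  run theta 0 n (fun k => `|k%:R - mean_tables n|) 0 <= E * S.
Proof.
move=> N0 nN; set s := E * S.
have S0 : 0 < S by rewrite sqrtr_gt0 ltr0n.
have s0 : 0 < s by rewrite mulr_gt0 // expR_gt0.
apply: le_trans (_ : run theta 0 n (fun k => (2 * s)^-1 * (k%:R - mean_tables n) ^+ 2 + s / 2) 0 <= _).
  apply: run_mono => // k _; rewrite -real_normK ?num_real //; set x := `|_|.
  have : 0 <= (2 * s)^-1 * (x - s) ^+ 2.
    by rewrite mulr_ge0 ?sqr_ge0 // invr_ge0 mulr_ge0 // ltW.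
  have -> : (2 * s)^-1 * (x - s) ^+ 2 = (2 * s)^-1 * x ^+ 2 + s / 2 - x.
    by field; rewrite gt_eqF.
  by rewrite subr_ge0.
rewrite run_affine -/(var_tables n).
have vs : var_tables n <= s ^+ 2.
  apply: le_trans (var_tables_le nN) _.
  by rewrite /s exprMn sqr_sqrtr // mulrC.
have : (2 * s)^-1 * var_tables n <= (2 * s)^-1 * s ^+ 2.
  by rewrite ler_wpM2l // invr_ge0 mulr_ge0 // ltW.
have -> : (2 * s)^-1 * s ^+ 2 = s / 2 by field; rewrite gt_eqF.
by lra.
Qed.

Lemma step_var_lip i x y : 0 <= x <= i%:R -> 0 <= y <= i%:R ->
  `|step_var i x - step_var i y| <= theta^-1 * `|x - y|.
Proof.
move=> xi yi; have /andP[p0 p1] := new_table_itv alpha01 theta0 xi.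
have /andP[q0 q1] := new_table_itv alpha01 theta0 yi.
have -> : step_var i x - step_var i y = (new_table theta i x - new_table theta i y) *
  (1 - new_table theta i x - new_table theta i y).
  by rewrite /step_var; ring.
rewrite normrM -[leRHS]mulr1 ler_pM //; last by rewrite ler_norml; apply/andP; split; lra.
have -> : new_table theta i x - new_table theta i y = (alpha / (theta + i%:R)) * (x - y).
  by rewrite /new_table; ring.
rewrite normrM ler_wpM2r // ger0_norm.
  apply: le_trans (invDn_le theta0 i); rewrite ler_piMl ?invr_ge0 //.
    by rewrite ltW // thetaDn_gt0.
  by case/andP: alpha01 => _ /ltW.
by rewrite divr_ge0 // ltW // thetaDn_gt0.
Qed.

(** The map p(1 - p) is Lipschitz with constant 1 / theta, so its fluctuations are
    those of K_i divided by theta, of order n^(-1/2). *)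
Lemma step_var_dev_le i : (0 < N)%N -> (i <= N)%N ->
  run theta 0 i (fun k => `|step_var i k%:R - mean_step_var i|) 0 <= 2 * (theta^-1 * (E * S)).
Proof.
move=> N0 iN; set b := step_var i (mean_tables i).
have D : run theta 0 i (fun k => `|step_var i k%:R - b|) 0 <= theta^-1 * (E * S).
  apply: le_trans (_ : run theta 0 i (fun k => theta^-1 * `|k%:R - mean_tables i| + 0) 0 <= _).
    apply: run_mono => // k ki; rewrite addr0; apply: step_var_lip.
      by rewrite ler0n ler_nat.
    exact: mean_tables_itv.
  rewrite run_affine addr0 ler_wpM2l ?invr_ge0 ?(ltW theta0) //.
  exact: abs_dev_le.
have mb : `|mean_step_var i - b| <= theta^-1 * (E * S).
  apply: le_trans D.
  have -> : mean_step_var i - b = run theta 0 i (fun k => step_var i k%:R - b) 0.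
    have -> : (fun k => step_var i k%:R - b) = (fun k => step_var i k%:R) \- (fun=> b) by [].
    by rewrite runB run_cst.
  exact: run_abs.
apply: le_trans (_ : run theta 0 i (fun k => 1 * `|step_var i k%:R - b| + theta^-1 * (E * S)) 0 <= _).
  apply: run_mono => // k ki; rewrite mul1r.
  have -> : step_var i k%:R - mean_step_var i = (step_var i k%:R - b) - (mean_step_var i - b) by ring.
  by apply: le_trans (ler_normB _ _) _; rewrite lerD2l.
by rewrite run_affine mul1r; lra.
Qed.

(** In [cov_tablesE], the random factor p_i (1 - p_i)(K_i) is replaced by its mean. *)
Lemma cov_tables_spliced n g F : (0 < n)%N -> (n <= N)%N -> 0 <= F -> (forall k, `|fdiff g k| <= F) ->
  `|cov_tables n g - \sum_(i < n) step_weight n i * spliced n i (fdiff g)| <= 2 * r * E ^+ 3 * S * F.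
Proof.
move=> n0 nN F0 gF; have N0 : (0 < N)%N by lia.
rewrite cov_tablesE // -sumrB; apply: le_trans (ler_norm_sum _ _ _) _.
have S0 : 0 <= S := sqrtr_ge0 _.
have step1 (i : 'I_n) : `|growths theta i.+1 (n - i.+1) ^+ 2 *
    run theta 0 i (fun k => step_var i k%:R * run (theta + alpha) i.+1 (n - i.+1) (fdiff g) k) 0
    - step_weight n i * spliced n i (fdiff g)| <= E ^+ 2 * (2 * (theta^-1 * (E * S)) * F).
  have /andP[g0 gE] := growths_sq_le i nN.
  rewrite /step_weight -mulrA -mulrBr normrM (ger0_norm g0) ler_pM //.
  rewrite /spliced; set h := run (theta + alpha) _ _ _.
  have -> : run theta 0 i (fun k => step_var i k%:R * h k) 0 - mean_step_var i * run theta 0 i h 0 =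
    run theta 0 i (fun k => (step_var i k%:R - mean_step_var i) * h k) 0.
    rewrite -[mean_step_var i * _]/((mean_step_var i \*o run theta 0 i h) 0) -runZ.
    rewrite -[LHS]/((run theta 0 i _ \- run theta 0 i _) 0) -runB.
    by congr (run _ _ _ _ _); apply/funext => k /=; rewrite mulrBl.
  apply: le_trans (_ : run theta 0 i (fun k => F * `|step_var i k%:R - mean_step_var i| + 0) 0 <= _).
    apply: run_abs => // k ki; rewrite addr0 normrM mulrC ler_wpM2r //.
    have := @run_abs _ _ alpha01 (theta + alpha) i.+1 (n - i.+1) (fdiff g) (fun=> F) k
      theta'0 (fun j _ => gF j) (leqW ki).
    by rewrite run_cst.
  rewrite run_affine addr0 mulrC ler_wpM2r //; apply: step_var_dev_le => //.
  by have := ltn_ord i; lia.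
apply: le_trans (ler_sum _ (fun i _ => step1 i)) _.
rewrite sumr_const card_ord -[leLHS]mulr_natl.
have -> : n%:R * (E ^+ 2 * (2 * (theta^-1 * (E * S)) * F)) = (n%:R / theta) * (2 * E ^+ 3 * S * F).
  by ring.
have -> : 2 * r * E ^+ 3 * S * F = r * (2 * E ^+ 3 * S * F) by ring.
rewrite ler_wpM2r ?(lerN_div theta0 rN) //.
by rewrite !mulr_ge0 // exprn_ge0.
Qed.

End concentration.

(** * The normal distribution and the Stein solution of a half-line *)

Section normal.
Variable R : realType.
Implicit Types x y z w : R.

Definition normal_density : R -> R := normal_pdf 0 1.
Definition normal_cdf x : R := fine (normal_prob (0 : R) 1 `]-oo, x]).

Lemma normal_cdfE x : normal_prob (0 : R) 1 `]-oo, x] = (normal_cdf x)%:E.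
Proof. by rewrite /normal_cdf fineK // fin_num_measure. Qed.

Lemma normal_cdf_ge0 x : 0 <= normal_cdf x.
Proof. by rewrite -lee_fin -normal_cdfE. Qed.

Lemma normal_cdf_le1 x : normal_cdf x <= 1.
Proof. by rewrite -lee_fin -normal_cdfE probability_le1. Qed.

Lemma normal_cdf_nd x y : x <= y -> normal_cdf x <= normal_cdf y.
Proof.
move=> xy; rewrite -lee_fin -!normal_cdfE le_measure ?inE //.
exact: subitvPr.
Qed.

Lemma normal_densityE x : normal_density x = normal_peak 1 * expR (- x ^+ 2 / 2).
Proof.
by rewrite /normal_density normal_pdfE ?oner_neq0 // /normal_fun subr0 expr1n.
Qed.

Lemma normal_density_gt0 x : 0 < normal_density x.
Proof. by rewrite normal_densityE mulr_gt0 ?expR_gt0 // normal_peak_gt0 ?oner_neq0. Qed.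

Lemma normal_density_le1 x : normal_density x <= 1.
Proof.
apply: le_trans (normal_pdf_ub 0 x (oner_neq0 R)) _.
rewrite /normal_peak expr1n mul1r.
have p1 : 1 <= pi *+ 2 :> R by have := pi_ge2 R; lra.
have s1 : 1 <= Num.sqrt (pi *+ 2) :> R.
  by rewrite -[leLHS]sqrtr1 ler_sqrt // (le_trans ler01).
by rewrite invf_le1 // (lt_le_trans ltr01).
Qed.

Lemma normal_density_ge1 x : `|x| <= 1 -> normal_density 1 <= normal_density x.
Proof.
move=> x1; rewrite !normal_densityE ler_wpM2l ?normal_peak_ge0 // ler_expR.
by rewrite ler_pM2r // lerN2 expr1n -real_normK ?num_real // exprn_ile1.
Qed.

Lemma normal_densityN x : normal_density (- x) = normal_density x.
Proof. by rewrite !normal_densityE sqrrN. Qed.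

Global Instance is_derive_normal_density x : is_derive x 1 normal_density (- x * normal_density x).
Proof.
have -> : normal_density = (fun y => normal_peak 1 * expR (- y ^+ 2 / 2)).
  by apply/funext => y; exact: normal_densityE.
apply: is_derive_eq.
by rewrite /= /GRing.scale /=; field.
Qed.

Global Instance is_derive_normal_cdf x : is_derive x 1 normal_cdf (normal_density x).
Proof.
have xx : x < x + 1 by rewrite ltrDl.
have ix : lebesgue_measure.-integrable [set` Interval -oo%O (BRight (x + 1))]
    (EFin \o normal_density).
  exact: integrableS (integrable_normal_pdf 0 1).
have cx : {for x, continuous normal_density}.
  by apply: continuous_normal_pdf; exact: oner_neq0.
have [dF F'] := continuous_FTC1 xx ix (ltNyr x) cx.
by apply: DeriveDef; [exact: dF|rewrite -derive1E; exact: F'].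
Qed.

Definition id_rv : measurableTypeR R -> R := idfun.
HB.instance Definition _ :=
  @isMeasurableFun.Build _ _ _ _ id_rv (@measurable_id _ _ setT).

Lemma cdf_id_rv : cdf (id_rv : {RV (normal_prob (0 : R) 1) >-> R}) = EFin \o normal_cdf.
Proof. by apply/funext => x; rewrite /= -normal_cdfE. Qed.

Lemma normal_cdf_cvgNy e : 0 < e -> exists A, forall x, x <= A -> normal_cdf x <= e.
Proof.
move=> e0.
have := cvg_cdfNy0 (id_rv : {RV (normal_prob (0 : R) 1) >-> R}).
rewrite cdf_id_rv => /fine_cvgP[_ /cvgr0_norm_le /(_ e e0)].
move=> [A [_ hA]]; exists (A - 1) => x xA; apply: le_trans (ler_norm _) _.
by apply: hA; rewrite /= (le_lt_trans xA) // ltrBlDr ltrDl.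
Qed.

Lemma normal_cdf_cvgy e : 0 < e -> exists A, forall x, A <= x -> 1 - e <= normal_cdf x.
Proof.
move=> e0.
have := cvg_cdfy1 (id_rv : {RV (normal_prob (0 : R) 1) >-> R}).
rewrite cdf_id_rv => /fine_cvgP[_ /cvgrPdist_le /(_ e e0)].
move=> [A [_ hA]]; exists (A + 1) => x xA.
have : `|1 - normal_cdf x| <= e by apply: hA => /=; rewrite (lt_le_trans _ xA) // ltrDl.
by move=> /(le_trans (ler_norm _)); lra.
Qed.

Lemma is_derive_continuous (f df : R -> R) (A : set R) :
  (forall x, is_derive x 1 f (df x)) -> {within A, continuous f}.
Proof.
move=> dfx; apply: continuous_subspaceT => x.
by apply: differentiable_continuous; apply/derivable1_diffP; case: (dfx x).
Qed.

(** The function x |-> phi(x) / (- w) - G(x) has derivative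
    (x / w - 1) phi(x) >= 0 on x <= w, and a nonnegative lower limit at minus
    infinity.  It is used for G = Phi and for the reflected tail
    x |-> 1 - Phi(- x), which has the same derivative. *)
Lemma mills (G : R -> R) w : (forall x, is_derive x 1 G (normal_density x)) ->
  (forall e, 0 < e -> exists A, forall x, x <= A -> G x <= e) ->
  w < 0 -> - w * G w <= normal_density w.
Proof.
move=> dG G0 w0; rewrite -(ler_pdivlMl _ _ (_ : 0 < - w)) ?oppr_gt0 //.
apply/ler_addgt0Pl => e e0; have [A GA] := G0 e e0.
pose P x := (- w)^-1 * normal_density x - G x.
have dP x : is_derive x 1 P ((x / w - 1) * normal_density x).
  apply: is_derive_eq; rewrite /GRing.scale /=.
  by field; rewrite lt_eqF.
pose x := Num.min A w.
have : P x <= P w.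
  apply: (@ger0_derive1_ndecrNy _ P w) => //.
  - move=> y; rewrite in_itv /= => yw; rewrite derive1E (@derive_val _ _ _ _ _ _ _ (dP y)).
    rewrite mulr_ge0 ?(ltW (normal_density_gt0 _)) // subr_ge0.
    rewrite -[y / w]mulrNN -invrN ler_pdivlMr ?oppr_gt0 // mul1r lerN2.
    exact: ltW.
  - exact: is_derive_continuous dP.
  - by rewrite /x ge_min lexx orbT.
rewrite /P => Pxw.
have Gx : G x <= e by apply: GA; rewrite /x ge_min lexx.
have : 0 <= (- w)^-1 * normal_density x.
  by rewrite mulr_ge0 ?invr_ge0 ?oppr_ge0 ?(ltW w0) // ltW // normal_density_gt0.
lra.
Qed.

Definition normal_ccdf x := 1 - normal_cdf x.

Lemma normal_ccdf_ge0 x : 0 <= normal_ccdf x. Proof. by rewrite subr_ge0 normal_cdf_le1. Qed.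
Lemma normal_ccdf_le1 x : normal_ccdf x <= 1. Proof. by rewrite gerBl normal_cdf_ge0. Qed.

Lemma millsl w : w < 0 -> - w * normal_cdf w <= normal_density w.
Proof. by apply: mills => // e /normal_cdf_cvgNy. Qed.

Lemma millsr w : 0 < w -> w * normal_ccdf w <= normal_density w.
Proof.
move=> w0.
suff H : - - w * normal_ccdf (- - w) <= normal_density (- w) by move: H; rewrite !opprK normal_densityN.
apply: (@mills (fun x => normal_ccdf (- x))).
- move=> x; rewrite /normal_ccdf; apply: is_derive_eq; rewrite /GRing.scale /=.
  by rewrite normal_densityN; ring.
- move=> e /normal_cdf_cvgy[A hA]; exists (- A) => x xA.
  by have := hA (- x); rewrite /normal_ccdf lerNr => /(_ xA); lra.
- by rewrite oppr_lt0.
Qed.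

Definition stein_cst : R := (normal_density 1)^-1 + 1.

Lemma stein_cst_ge1 : 1 <= stein_cst.
Proof. by rewrite /stein_cst lerDr invr_ge0 ltW // normal_density_gt0. Qed.

(** The value 1 comes from Mills' inequality for |w| > 1, and 1 / phi(1) from the
    monotonicity of phi in |w| for |w| <= 1. *)
Lemma stein_bound w : normal_cdf w * normal_ccdf w / normal_density w <= stein_cst.
Proof.
have p0 := normal_density_gt0 w; have F0 := normal_cdf_ge0 w; have F1 := normal_cdf_le1 w.
have C0 := normal_ccdf_ge0 w; have C1 := normal_ccdf_le1 w.
have [w1|w1] := leP `|w| 1.
  have p1 := normal_density_ge1 w1; have q0 := normal_density_gt0 1.
  apply: le_trans (_ : (normal_density 1)^-1 <= _); last by rewrite /stein_cst lerDl.
  apply: le_trans (_ : (normal_density w)^-1 <= _); last by rewrite lef_pV2.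
  by rewrite ler_piMl ?invr_ge0 ?(ltW p0) // mulr_ile1.
apply: le_trans stein_cst_ge1; rewrite ler_pdivrMr // mul1r.
case: (ltP w 0) => w0.
  have := millsl w0; move: w1; rewrite ltr0_norm // => w1.
  nra.
have w00 : 0 < w by move: w1; rewrite ger0_norm //; lra.
have := millsr w00; move: w1; rewrite ger0_norm // => w1.
nra.
Qed.

Lemma stein_bound_mul w : `|w| * (normal_cdf w * normal_ccdf w / normal_density w) <= 1.
Proof.
have p0 := normal_density_gt0 w; have F0 := normal_cdf_ge0 w; have F1 := normal_cdf_le1 w.
have C0 := normal_ccdf_ge0 w; have C1 := normal_ccdf_le1 w.
rewrite mulrA ler_pdivrMr // mul1r.
case: (ltgtP w 0) => w0.
- have := millsl w0; rewrite ltr0_norm //; nra.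
- have := millsr w0; rewrite gtr0_norm //; nra.
- by rewrite w0 normr0 mul0r ltW ?normal_density_gt0.
Qed.

(** The bounded solution of f'(w) - w f(w) = 1(w <= z) - Phi(z). *)
Definition stein_sol z w := if w <= z then normal_ccdf z * (normal_cdf w / normal_density w)
  else normal_cdf z * (normal_ccdf w / normal_density w).

Lemma stein_rightE z w : z <= w -> stein_sol z w = normal_cdf z * (normal_ccdf w / normal_density w).
Proof.
move=> zw; rewrite /stein_sol; case: ifP => // wz.
by have -> : w = z by [apply: le_anti; rewrite wz]; ring.
Qed.

Lemma stein_ge0 z w : 0 <= stein_sol z w.
Proof.
by rewrite /stein_sol; case: ifP => _; rewrite !mulr_ge0 ?invr_ge0 ?normal_cdf_ge0 ?normal_ccdf_ge0 // ltW // normal_density_gt0.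
Qed.

Lemma stein_le z w : stein_sol z w <= normal_cdf w * normal_ccdf w / normal_density w.
Proof.
have p0 := normal_density_gt0 w; rewrite /stein_sol; case: ifP => wz.
  rewrite mulrA ler_pM2r ?invr_gt0 // [leRHS]mulrC ler_wpM2r ?normal_cdf_ge0 //.
  by rewrite /normal_ccdf lerD2l lerN2 normal_cdf_nd.
rewrite mulrA ler_pM2r ?invr_gt0 // ler_wpM2r ?normal_ccdf_ge0 //.
by rewrite normal_cdf_nd // ltW // real_ltNge ?num_real // wz.
Qed.

Lemma stein_le_cst z w : stein_sol z w <= stein_cst.
Proof. exact: le_trans (stein_le _ _) (stein_bound _). Qed.

Lemma stein_mul_le1 z w : `|w * stein_sol z w| <= 1.
Proof.
rewrite normrM [X in _ * X]ger0_norm ?stein_ge0 //.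
by apply: le_trans (stein_bound_mul w); rewrite ler_wpM2l ?stein_le.
Qed.

(** On each side of z the solution is smooth, and its derivative is given by the
    Stein equation.  At the point z itself both formulas agree. *)
Lemma stein_mvt z x y : x < y -> (y <= z) || (z <= x) ->
  exists2 c, x <= c <= y &
    stein_sol z y - stein_sol z x = (c * stein_sol z c + (y <= z)%R%:R - normal_cdf z) * (y - x).
Proof.
move=> xy; have normal_density0 w : normal_density w != 0 by rewrite gt_eqF // normal_density_gt0.
case: (boolP (y <= z)) => [yz _|_ /= zx].
  pose f w := normal_ccdf z * (normal_cdf w / normal_density w).
  pose df w := w * f w + 1 - normal_cdf z.
  have df' w : is_derive w 1 f (df w).
    apply: is_derive_eq; rewrite /GRing.scale /df /f /normal_ccdf /=.
    by field.
  have [c] := @MVT _ f df x y xy (fun w _ => df' w)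
    (is_derive_continuous df').
  rewrite in_itv /= => /andP[xc cy] E; exists c; first by rewrite (ltW xc) (ltW cy).
  have st w : w <= y -> stein_sol z w = f w by move=> wy; rewrite /stein_sol (le_trans wy yz).
  by rewrite (st y) // (st x) ?(ltW xy) // (st c) ?(ltW cy).
pose f w := normal_cdf z * (normal_ccdf w / normal_density w).
pose df w := w * f w + 0 - normal_cdf z.
have df' w : is_derive w 1 f (df w).
  apply: is_derive_eq; rewrite /GRing.scale /df /f /normal_ccdf /=.
  by field.
have [c] := @MVT _ f df x y xy (fun w _ => df' w)
  (is_derive_continuous df').
rewrite in_itv /= => /andP[xc cy] E; exists c; first by rewrite (ltW xc) (ltW cy).
have st w : x <= w -> stein_sol z w = f w by move=> wy; rewrite stein_rightE // (le_trans zx).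
by rewrite (st x) // (st y) ?(ltW xy) // (st c) ?(ltW xc).
Qed.

Lemma stein_lip z x y : x <= y -> (y <= z) || (z <= x) ->
  `|stein_sol z y - stein_sol z x| <= 2 * (y - x).
Proof.
rewrite le_eqVlt => /predU1P[->|xy yzx]; first by rewrite !subrr normr0 mulr0.
have [c _ ->] := stein_mvt xy yzx.
rewrite normrM [X in _ * X]gtr0_norm ?subr_gt0 // ler_wpM2r ?subr_ge0 ?(ltW xy) //.
rewrite -addrA; apply: le_trans (ler_normD _ _) _.
have := stein_mul_le1 z c.
suff : `|(y <= z)%R%:R - normal_cdf z| <= 1 by lra.
have := normal_cdf_ge0 z; have := normal_cdf_le1 z.
by case: (y <= z) => /= ? ?; rewrite ler_norml; apply/andP; split; lra.
Qed.

Lemma normal_cdf_lip x y : x <= y -> normal_cdf y <= normal_cdf x + (y - x).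
Proof.
rewrite le_eqVlt => /predU1P[->|xy]; first by rewrite subrr addr0.
have [c _] := @MVT _ normal_cdf normal_density x y xy (fun w _ => is_derive_normal_cdf w)
  (is_derive_continuous is_derive_normal_cdf).
have : normal_density c * (y - x) <= y - x by rewrite ler_piMl ?normal_density_le1 // subr_ge0 ltW.
lra.
Qed.

End normal.

(** * Stein identity on the lattice of the standardized count *)

Section stein_chain.
Variables (R : realType) (alpha theta r : R) (n : nat) (a s c1 c2 : R).
Hypotheses (alpha01 : 0 <= alpha < 1) (theta0 : 0 < theta)
  (rn : n%:R <= r * theta) (n0 : (0 < n)%N) (s0 : 0 < s).
Local Notation run := (run alpha).
Local Notation mean_tables := (mean_tables alpha theta).
Local Notation cov_tables := (cov_tables alpha theta).
Local Notation spliced := (spliced alpha theta).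
Local Notation var_tables := (var_tables alpha theta).
Local Notation step_weight := (step_weight alpha theta).
Let S := Num.sqrt (n%:R : R).
Let b := s * S.
Hypotheses (ha : `|mean_tables n - a| <= c1) (hb : `|var_tables n - b ^+ 2| <= c2).
Let E := expR r.
Let mc := spliced_cst r.
Let B := stein_cst R.
Let theta'0 : 0 < theta + alpha.
Proof. by case/andP: alpha01 => a0 _; have := theta0; lra. Qed.

(** The value of the standardized count when there are k tables, with centring a
    and scale s sqrt(n). *)
Definition lattice k : R := (k%:R - a) / b.

Let S0 : 0 < S. Proof. by rewrite sqrtr_gt0 ltr0n. Qed.
Let b0 : 0 < b. Proof. exact: mulr_gt0. Qed.
Let d := b^-1.
Let d0 : 0 < d. Proof. by rewrite invr_gt0. Qed.

Lemma latticeS k : lattice k.+1 = lattice k + d.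
Proof. by rewrite /lattice -natr1 /d; ring. Qed.

Lemma lattice_le j k : (lattice j <= lattice k) = (j <= k)%N.
Proof. by rewrite ler_pM2r // lerD2r ler_nat. Qed.

Lemma spliced_lin m c g h :
  spliced n m (fun k => c * g k + h k) = c * spliced n m g + spliced n m h.
Proof.
rewrite /spliced.
have -> : (fun k => c * g k + h k) = (c \*o g) \+ h by [].
by rewrite !runD !runZ.
Qed.

Lemma spliced_const m c : spliced n m (fun=> c) = c.
Proof. by rewrite /spliced !run_cst. Qed.

Lemma spliced_abs m g h : (forall k, `|g k| <= h k) -> `|spliced n m g| <= spliced n m h.
Proof.
move=> gh; apply: run_abs => // k km; apply: run_abs => //.
by rewrite leqW.
Qed.

Variable k0 : nat.
Let z := lattice k0.
Let f k := stein_sol z (lattice k).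
Let g k := lattice k * f k.
Let V k := d * (B + 2 * `|lattice k|).

Let one_side k : (lattice k.+1 <= z) || (z <= lattice k).
Proof. by rewrite /z !lattice_le; case: ltnP. Qed.

Let dk k : lattice k <= lattice k.+1.
Proof. by rewrite lattice_le. Qed.

Lemma fdiff_stein_le k : `|fdiff f k| <= 2 * d.
Proof.
have := stein_lip (dk k) (one_side k).
by rewrite {2}latticeS addrAC subrr add0r.
Qed.

Lemma fdiff_mul_le k : `|fdiff g k| <= V k.
Proof.
have -> : fdiff g k = d * f k.+1 + lattice k * fdiff f k.
  by rewrite /g /fdiff latticeS; ring.
apply: le_trans (ler_normD _ _) _; rewrite (normrM d) (normrM (lattice k)) /V mulrDr.
apply: lerD.
  by rewrite (gtr0_norm d0) ler_pM2l // ger0_norm ?stein_ge0 // stein_le_cst.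
apply: le_trans (ler_wpM2l (normr_ge0 _) (fdiff_stein_le k)) _.
by rewrite le_eqVlt; apply/orP; left; apply/eqP; ring.
Qed.

(** By the mean value theorem the slope is the derivative of the Stein solution
    at a point c of the step, where the Stein equation gives
    c f(c) + 1(k < k0) - Phi(z); moving c to the left end changes c f(c) by at
    most V k. *)
Lemma stein_remainder k :
  `|b * fdiff f k - (g k + (k < k0)%N%:R - normal_cdf z)| <= V k.
Proof.
have xy : lattice k < lattice k.+1 by rewrite latticeS ltrDl.
have [c /andP[c1' c2'] E1] := stein_mvt xy (one_side k).
have bd : b * d = 1 by rewrite divff // gt_eqF.
have cd : lattice k <= c <= lattice k + d by rewrite c1' -latticeS.
have ck : (c <= z) || (z <= lattice k).
  by case/orP: (one_side k) => h; apply/orP; [left; exact: le_trans h|right].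
have fc : `|stein_sol z c - f k| <= 2 * d.
  apply: le_trans (stein_lip c1' ck) _; rewrite ler_pM2l //.
  by case/andP: cd => _; rewrite -lerBlDl.
have ind : (lattice k.+1 <= z)%R = (k < k0)%N by rewrite lattice_le.
have E2 : b * fdiff f k = c * stein_sol z c + (k < k0)%N%:R - normal_cdf z.
  rewrite /fdiff /f E1 ind latticeS; set q := _ - normal_cdf z.
  by rewrite addrAC subrr add0r mulrCA bd mulr1.
rewrite E2.
have -> : c * stein_sol z c + (k < k0)%N%:R - normal_cdf z - (g k + (k < k0)%N%:R - normal_cdf z) =
   (c - lattice k) * stein_sol z c + lattice k * (stein_sol z c - f k) by rewrite /g; ring.
apply: le_trans (ler_normD _ _) _.
rewrite (normrM (c - lattice k)) (normrM (lattice k)) /V mulrDr.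
case/andP: cd => cd1 cd2; apply: lerD.
  rewrite ger0_norm ?subr_ge0 // ler_pM ?subr_ge0 ?normr_ge0 //.
    by rewrite lerBlDl.
  by rewrite ger0_norm ?stein_ge0 // stein_le_cst.
apply: le_trans (ler_wpM2l (normr_ge0 _) fc) _.
by rewrite le_eqVlt; apply/orP; left; apply/eqP; ring.
Qed.

Lemma fdiff_V_le k : `|fdiff V k| <= 2 * d ^+ 2.
Proof.
have -> : fdiff V k = 2 * d * (`|lattice k.+1| - `|lattice k|).
  by rewrite /V /fdiff; ring.
rewrite normrM ger0_norm ?mulr_ge0 ?(ltW d0) // expr2 mulrA ler_pM2l ?mulr_gt0 //.
apply: le_trans (ler_dist_dist _ _) _.
by rewrite latticeS addrAC subrr add0r gtr0_norm.
Qed.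

Let EV := run theta 0 n V 0.
Let Eg := run theta 0 n g 0.

Let d20 : 0 <= 2 * d ^+ 2. Proof. by rewrite mulr_ge0 // sqr_ge0. Qed.

Lemma spliced_V_le i : (i < n)%N -> spliced n i V <= EV + mc * (2 * d ^+ 2).
Proof.
move=> ni.
have := spliced_close alpha01 theta0 rn ni (leqnn n) (lexx 0) fdiff_V_le
  (fun j => _ : `|fdiff (fun=> 2 * d ^+ 2) j| <= 0).
rewrite run_cst addr0 => H; have {}H : `|spliced n i V - EV| <= mc * (2 * d ^+ 2).
  by apply: H => j; rewrite /fdiff subrr normr0.
by have := le_trans (ler_norm _) H; lra.
Qed.

Lemma spliced_stein i : (i < n)%N ->
  `|b * spliced n i (fdiff f) - (Eg + spliced n i (fun k => (k < k0)%N%:R) - normal_cdf z)|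
   <= (1 + mc) * EV + 4 * mc * d ^+ 2.
Proof.
move=> ni.
have H1 := spliced_close alpha01 theta0 rn ni (leqnn n) d20 fdiff_mul_le fdiff_V_le.
have H2 : `|spliced n i (fun k => b * fdiff f k - (g k + (k < k0)%N%:R - normal_cdf z))| <= spliced n i V.
  by apply: spliced_abs; exact: stein_remainder.
have H3 := spliced_V_le ni.
have E1 : spliced n i (fun k => b * fdiff f k - (g k + (k < k0)%N%:R - normal_cdf z)) =
  b * spliced n i (fdiff f) - spliced n i g - spliced n i (fun k => (k < k0)%N%:R) + normal_cdf z.
  rewrite spliced_lin.
  have -> : (fun k => - (g k + (k < k0)%N%:R - normal_cdf z)) =
    (fun k => -1 * g k + (-1 * (k < k0)%N%:R + normal_cdf z)) by apply/funext => k; ring.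
  by rewrite spliced_lin spliced_lin spliced_const; ring.
rewrite E1 in H2; rewrite -/EV -/Eg in H1.
set q := spliced n i (fun k => (k < k0)%N%:R) in H2 *.
have -> : b * spliced n i (fdiff f) - (Eg + q - normal_cdf z) =
  (b * spliced n i (fdiff f) - spliced n i g - q + normal_cdf z) + (spliced n i g - Eg) by ring.
apply: le_trans (ler_normD _ _) _.
by have := lerD (le_trans H2 H3) H1; rewrite /mc; lra.
Qed.

Lemma var_tables_ge0 : 0 <= var_tables n.
Proof. by rewrite var_tablesE // sumr_ge0 // => i _; exact: step_weight_ge0. Qed.

(** The Stein identity for f at the lattice point z: [cov_tables_spliced] evaluates
    E[(K_n - E K_n) f(K_n)], [stein_remainder] replaces the increments of f by
    the Stein equation, and the terms in w f(w) on both sides cancel up to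
    [spliced_close]. *)
Lemma stein_sum :
  `|(b ^+ 2)^-1 * (\sum_(i < n) step_weight n i * spliced n i (fun k => (k < k0)%N%:R)) - normal_cdf z|
  <= 4 * r * E ^+ 3 * S / b ^+ 2 + c1 * B / b + 2 * c2 / b ^+ 2
     + var_tables n / b ^+ 2 * ((1 + mc) * EV + 4 * mc * d ^+ 2).
Proof.
set M := (1 + mc) * EV + _.
set X := \sum_(i < n) _.
have b20 : 0 < b ^+ 2 by rewrite exprn_gt0.
have bn : b != 0 by rewrite gt_eqF.
have H1 := cov_tables_spliced alpha01 theta0 rn n0 (leqnn n) (_ : 0 <= 2 * d) fdiff_stein_le.
have {}H1 := H1 (mulr_ge0 (ler0n _ 2) (ltW d0)).
rewrite -/E -/S in H1.
set Y := \sum_(i < n) _ in H1.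
have H2 : `|b * Y - (var_tables n * (Eg - normal_cdf z) + X)| <= var_tables n * M.
  rewrite var_tablesE // mulr_sumr !mulr_suml -big_split -sumrB /=.
  apply: le_trans (ler_norm_sum _ _ _) _; apply: ler_sum => i _.
  have -> : forall w m q, b * (w * m) - (w * (Eg - normal_cdf z) + w * q) =
     w * (b * m - (Eg + q - normal_cdf z)) by move=> *; ring.
  rewrite normrM ger0_norm ?step_weight_ge0 // ler_wpM2l ?step_weight_ge0 //.
  exact: spliced_stein.
have H3 : b * Eg = cov_tables n f + (mean_tables n - a) * run theta 0 n f 0.
  rewrite -[b * Eg]/((b \*o run theta 0 n g) 0) -runZ.
  have -> : b \*o g = (fun k => (k%:R - mean_tables n) * f k) \+ ((mean_tables n - a) \*o f).
    apply/funext => k /=; rewrite /g /lattice; field; exact: bn.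
  by rewrite runD runZ.
have Ef : `|run theta 0 n f 0| <= B.
  apply: le_trans (_ : run theta 0 n (fun=> B) 0 <= _); last by rewrite run_cst.
  by apply: run_abs => // k _; rewrite ger0_norm ?stein_ge0 // stein_le_cst.
have Eg1 : `|Eg| <= 1.
  apply: le_trans (_ : run theta 0 n (fun=> 1) 0 <= _); last by rewrite run_cst.
  by apply: run_abs => // k _; exact: stein_mul_le1.
have c10 : 0 <= c1 by apply: le_trans ha.
have c20 : 0 <= c2 by apply: le_trans hb.
rewrite -(ler_pM2l b20) -[X in X * `|_|](gtr0_norm b20) -normrM.
have -> : b ^+ 2 * ((b ^+ 2)^-1 * X - normal_cdf z) =
  - (b * Y - (var_tables n * (Eg - normal_cdf z) + X)) - b * (cov_tables n f - Y)
  - b * ((mean_tables n - a) * run theta 0 n f 0)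
  - (var_tables n - b ^+ 2) * (Eg - normal_cdf z) .
  have -> : cov_tables n f = b * Eg - (mean_tables n - a) * run theta 0 n f 0 by rewrite H3; ring.
  have -> : b ^+ 2 * ((b ^+ 2)^-1 * X - normal_cdf z) = X - b ^+ 2 * normal_cdf z.
    by field.
  by ring.
have T1 : `|b * (cov_tables n f - Y)| <= 4 * r * E ^+ 3 * S.
  rewrite normrM (gtr0_norm b0); apply: le_trans (ler_wpM2l (ltW b0) H1) _.
  have bd : b * d = 1 by rewrite divff.
  have -> : b * (2 * r * E ^+ 3 * S * (2 * d)) = (b * d) * (4 * r * E ^+ 3 * S) by ring.
  by rewrite bd mul1r.
have T2 : `|b * ((mean_tables n - a) * run theta 0 n f 0)| <= b * (c1 * B).
  by rewrite normrM (gtr0_norm b0) ler_pM2l // normrM ler_pM.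
have T3 : `|(var_tables n - b ^+ 2) * (Eg - normal_cdf z)| <= 2 * c2.
  rewrite normrM [leRHS]mulrC ler_pM //.
  have := normal_cdf_ge0 z; have := normal_cdf_le1 z; move: Eg1; rewrite !ler_norml.
  by move=> /andP[? ?] ? ?; apply/andP; split; lra.
have -> : b ^+ 2 * (4 * r * E ^+ 3 * S / b ^+ 2 + c1 * B / b + 2 * c2 / b ^+ 2 + var_tables n / b ^+ 2 * M)
  = var_tables n * M + 4 * r * E ^+ 3 * S + b * (c1 * B) + 2 * c2.
  by field.
do 3! (apply: le_trans (ler_normB _ _) _; apply: lerD => //).
by rewrite normrN.
Qed.

End stein_chain.

(** * Kolmogorov distance *)

Lemma minn_subnS_le L m k : (minn L (m - k.+1) <= minn L (m - k))%N.
Proof. lia. Qed.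

Lemma minn_subnS_close L m k : (minn L (m - k) - minn L (m - k.+1) <= 1)%N.
Proof. lia. Qed.

Lemma leq_minn_sub L m k : (k < m)%N -> (L <= minn L (m + L - k))%N.
Proof. lia. Qed.

Section kolmogorov.
Variables (R : realType) (alpha theta r : R) (n : nat) (a s c1 c2 : R).
Hypotheses (alpha01 : 0 <= alpha < 1) (theta0 : 0 < theta)
  (rn : n%:R <= r * theta) (n0 : (0 < n)%N) (s0 : 0 < s).
Local Notation run := (run alpha).
Local Notation mean_tables := (mean_tables alpha theta).
Local Notation spliced := (spliced alpha theta).
Local Notation var_tables := (var_tables alpha theta).
Local Notation step_weight := (step_weight alpha theta).
Let S := Num.sqrt (n%:R : R).
Let b := s * S.
Hypotheses (ha : `|mean_tables n - a| <= c1) (hb : `|var_tables n - b ^+ 2| <= c2).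
Let E := expR r.
Let mc := spliced_cst r.
Let B := stein_cst R.
Local Notation lattice := (lattice n a s).
Let d := b^-1.

Let S0 : 0 < S. Proof. by rewrite sqrtr_gt0 ltr0n. Qed.
Let S1 : 1 <= S.
Proof. by rewrite -[leLHS]sqrtr1 ler_sqrt // ler1n. Qed.
Let b0 : 0 < b. Proof. exact: mulr_gt0. Qed.
Let d0 : 0 < d. Proof. by rewrite invr_gt0. Qed.
Let c10 : 0 <= c1. Proof. exact: le_trans ha. Qed.
Let c20 : 0 <= c2. Proof. exact: le_trans hb. Qed.
Let r0 : 0 <= r.
Proof. by rewrite -(pmulr_lge0 _ theta0); apply: le_trans rn. Qed.
Let B0 : 0 <= B. Proof. exact: le_trans (stein_cst_ge1 R). Qed.
Let mc0 : 0 <= mc.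
Proof. by rewrite /mc /spliced_cst addr_ge0 ?mulr_ge0 ?sqr_ge0 ?addr_ge0 ?mulr_ge0 ?expR_ge0. Qed.
Let theta'0 : 0 < theta + alpha.
Proof. by case/andP: alpha01 => a0 _; have := theta0; lra. Qed.

(** The four summands bound, in order, those of [stein_sum] multiplied by
    sqrt(n); only their independence of n matters. *)
Definition lattice_cst : R := 4 * r * E ^+ 3 / s ^+ 2 + c1 * B / s + 2 * c2 / s ^+ 2
  + (1 + c2 / s ^+ 2) * ((1 + mc) * ((B + 2 * ((E + c1) / s)) / s) + 4 * mc / s ^+ 2).

Let invS2 : (S ^+ 2)^-1 <= S^-1.
Proof. by rewrite lef_pV2 ?posrE ?exprn_gt0 // expr2 ler_peMr // ltW. Qed.

Lemma run_lattice_le : run theta 0 n (fun k => `|lattice k|) 0 <= (E + c1) / s.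
Proof.
apply: le_trans (_ : run theta 0 n (fun k => d * `|k%:R - mean_tables n| + d * c1) 0 <= _).
  apply: run_mono => // k _; rewrite /lattice -/S -/b -/d normrM [X in _ * X]gtr0_norm // mulrC.
  rewrite -mulrDr ler_pM2l //.
  have -> : k%:R - a = (k%:R - mean_tables n) + (mean_tables n - a) by ring.
  by apply: le_trans (ler_normD _ _) _; rewrite lerD2l.
rewrite run_affine -mulrDr.
have := abs_dev_le alpha01 theta0 rn n0 (leqnn n); rewrite -/E -/S => H.
apply: le_trans (_ : d * (E * S + c1 * S) <= _).
  by rewrite ler_pM2l // lerD // ler_peMr.
rewrite le_eqVlt; apply/orP; left; apply/eqP; rewrite /d /b.
by field; rewrite (gt_eqF s0) gt_eqF.
Qed.

Lemma var_tables_ratio : var_tables n / b ^+ 2 <= 1 + c2 / s ^+ 2.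
Proof.
have b20 : 0 < b ^+ 2 by rewrite exprn_gt0.
rewrite ler_pdivrMr //.
have : var_tables n <= b ^+ 2 + c2 by have := le_trans (ler_norm _) hb; lra.
move=> /le_trans; apply; rewrite mulrDl mul1r lerD2l.
have -> : c2 / s ^+ 2 * b ^+ 2 = c2 * S ^+ 2 by rewrite /b; field; rewrite gt_eqF.
by rewrite ler_peMr // exprn_ege1.
Qed.

(** All four terms of [stein_sum] are of order n^(-1/2), the last one because
    the standardized count has a bounded first absolute moment. *)
Lemma lattice_bound k0 :
  `|(b ^+ 2)^-1 * (\sum_(i < n) step_weight n i * spliced n i (fun k => (k < k0)%N%:R))
    - normal_cdf (lattice k0)| <= lattice_cst / S.
Proof.
have sn : s != 0 by rewrite gt_eqF.
have Sn : S != 0 by rewrite gt_eqF.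
apply: le_trans (stein_sum alpha01 theta0 rn n0 s0 ha hb k0) _.
rewrite -/S -/b -/E -/mc -/B -/d.
have dE : d = s^-1 * S^-1 by rewrite /d /b invfM.
have s20 : 0 < s ^+ 2 by rewrite exprn_gt0.
have b2E : (b ^+ 2)^-1 = (s ^+ 2)^-1 * (S ^+ 2)^-1 by rewrite /b exprMn invfM.
have is0 : 0 <= (s ^+ 2)^-1 by rewrite invr_ge0 ltW.
set EV := run theta 0 n _ 0.
have EVle : EV <= (B + 2 * ((E + c1) / s)) / s / S.
  rewrite /EV.
  have -> : (fun k => d * (B + 2 * `|lattice k|)) = (fun k => (2 * d) * `|lattice k| + d * B).
    by apply/funext => k; ring.
  rewrite run_affine.
  have := run_lattice_le => /(ler_wpM2l (ltW (mulr_gt0 (ltr0Sn R 1) d0))).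
  set q := (E + c1) / s; set x := run _ _ _ _ _ => H.
  have -> : (B + 2 * q) / s / S = 2 * d * q + d * B by rewrite dE; ring.
  by rewrite lerD2r.
have Mle : (1 + mc) * EV + 4 * mc * d ^+ 2 <=
   ((1 + mc) * ((B + 2 * ((E + c1) / s)) / s) + 4 * mc / s ^+ 2) / S.
  rewrite [leRHS]mulrDl; apply: lerD.
    by rewrite -mulrA ler_wpM2l // addr_ge0.
  rewrite /d exprVn b2E -!mulrA ler_wpM2l // ler_wpM2l // ler_wpM2l //.
set X := (1 + mc) * _ + _ in Mle *.
set Y := ((1 + mc) * _ + _) / S in Mle.
have -> : lattice_cst / S = 4 * r * E ^+ 3 / s ^+ 2 / S + c1 * B / s / S
    + 2 * c2 / s ^+ 2 / S + (1 + c2 / s ^+ 2) * Y by rewrite /lattice_cst /Y; ring.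
apply: lerD; first apply: lerD; first apply: lerD.
- by rewrite b2E le_eqVlt; apply/orP; left; apply/eqP; field; rewrite sn Sn.
- by rewrite -/d dE le_eqVlt; apply/orP; left; apply/eqP; ring.
- by rewrite b2E mulrA ler_wpM2l // mulr_ge0 // mulr_ge0.
apply: ler_pM => //.
- by rewrite divr_ge0 ?sqr_ge0 //; exact: var_tables_ge0.
- have EV0 : 0 <= EV.
    by apply: run_ge0 => // k; rewrite mulr_ge0 ?(ltW d0) // addr_ge0 // mulr_ge0.
  by apply: addr_ge0; [rewrite mulr_ge0 // addr_ge0|rewrite mulr_ge0 ?sqr_ge0 // mulr_ge0].
- exact: var_tables_ratio.
Qed.

Definition below k0 := run theta 0 n (fun k => (k < k0)%N%:R) 0.

Lemma below_itv k0 : 0 <= below k0 <= 1.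
Proof.
apply/andP; split; first by apply: run_ge0.
by apply: run_le_cst => // k _; case: ltnP.
Qed.

Lemma lattice_shift k L : lattice (k + L) = lattice k + L%:R * d.
Proof. by rewrite /lattice natrD -/S -/b /d; ring. Qed.

(** If counting below a threshold differs between the chain and the spliced
    chains by a shift of L and an error e, then [lattice_bound] transfers to the
    chain with an additional L lattice steps and a multiple of e. *)
Lemma below_normal_cdf (L : nat) e k0 : 0 <= e ->
  (forall i j, (i < n)%N -> below j <= spliced n i (fun k => (k < j + L)%N%:R) + e) ->
  (forall i j, (i < n)%N -> spliced n i (fun k => (k < j)%N%:R) <= below (j + L) + e) ->
  `|below k0 - normal_cdf (lattice k0)| <=
    (lattice_cst + c2 / s ^+ 2) / S + L%:R * d + (1 + c2 / s ^+ 2) * e.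
Proof.
move=> e0 H1 H2.
have b20 : 0 < b ^+ 2 by rewrite exprn_gt0.
set rho := var_tables n / b ^+ 2.
have rho0 : 0 <= rho by rewrite divr_ge0 ?(ltW b20) //; exact: var_tables_ge0.
have rho1 : rho <= 1 + c2 / s ^+ 2 := var_tables_ratio.
have rhod : `|rho - 1| <= c2 / s ^+ 2 / S.
  have -> : rho - 1 = (var_tables n - b ^+ 2) / b ^+ 2.
    by rewrite /rho; field; rewrite gt_eqF.
  rewrite normrM [X in _ * X]gtr0_norm ?invr_gt0 //.
  apply: le_trans (ler_wpM2r _ hb) _; first by rewrite invr_ge0 ltW.
  rewrite /b exprMn invfM mulrA ler_wpM2l //.
  by rewrite mulr_ge0 // invr_ge0 sqr_ge0.
pose avg j := (b ^+ 2)^-1 * (\sum_(i < n) step_weight n i * spliced n i (fun k => (k < j)%N%:R)).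
have avgE (u : R) : rho * u = (b ^+ 2)^-1 * \sum_(i < n) step_weight n i * u.
  by rewrite -mulr_suml -var_tablesE // /rho; ring.
have up : rho * below k0 <= avg (k0 + L)%N + rho * e.
  rewrite !avgE /avg -mulrDr ler_wpM2l ?invr_ge0 ?(ltW b20) // -big_split /=.
  by apply: ler_sum => i _; rewrite -mulrDr ler_wpM2l ?step_weight_ge0 // H1.
have lo : avg (k0 - L)%N <= rho * below k0 + rho * e.
  rewrite !avgE /avg -mulrDr ler_wpM2l ?invr_ge0 ?(ltW b20) // -big_split /=.
  apply: ler_sum => i _; rewrite -mulrDr ler_wpM2l ?step_weight_ge0 //.
  (* For k0 < L the truncated difference is 0, and no count lies below 0. *)
  case: (leqP L k0) => Lk; first by have := H2 i (k0 - L)%N (ltn_ord i); rewrite subnK.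
  have -> : (k0 - L = 0)%N by apply/eqP; rewrite subn_eq0 ltnW.
  have -> : (fun k => (k < 0)%N%:R) = fun=> 0 :> R by apply/funext => k; rewrite ltn0.
  rewrite spliced_const addr_ge0 //.
  by case/andP: (below_itv k0).
have e1 : rho * e <= (1 + c2 / s ^+ 2) * e by rewrite ler_wpM2r.
have Lu : normal_cdf (lattice (k0 + L)%N) <= normal_cdf (lattice k0) + L%:R * d.
  have := @normal_cdf_lip R (lattice k0) (lattice (k0 + L)%N).
  by rewrite lattice_shift lerDl mulr_ge0 ?(ltW d0) // addrAC subrr add0r; apply.
have Ll : normal_cdf (lattice k0) <= normal_cdf (lattice (k0 - L)%N) + L%:R * d.
  have := @normal_cdf_lip R (lattice (k0 - L)%N) (lattice (k0 - L + L)%N).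
  rewrite lattice_shift lerDl mulr_ge0 ?(ltW d0) // addrAC subrr add0r => /(_ isT).
  apply: le_trans; apply: normal_cdf_nd; rewrite -lattice_shift lattice_le //.
  by rewrite addnC -leq_subLR.
have Bu := lattice_bound (k0 + L); have Bl := lattice_bound (k0 - L).
rewrite -/(avg _) in Bu; rewrite -/(avg _) in Bl.
have dd : `|rho * below k0 - below k0| <= c2 / s ^+ 2 / S.
  rewrite -[X in _ - X]mul1r -mulrBl normrM.
  have /andP[b00 b01] := below_itv k0.
  by rewrite (ger0_norm b00); apply: le_trans rhod; rewrite ler_piMr.
have -> : (lattice_cst + c2 / s ^+ 2) / S = lattice_cst / S + c2 / s ^+ 2 / S by ring.
move: Bu Bl dd; rewrite !ler_norml => /andP[? ?] /andP[? ?] /andP[? ?].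
by apply/andP; split; lra.
Qed.

(** Between two lattice points the distribution function of the count is constant
    and Phi varies by at most the lattice step. *)
Lemma run_cdf D : (forall k0, `|below k0 - normal_cdf (lattice k0)| <= D) -> forall x,
  `|run theta 0 n (fun k => (lattice k <= x)%R%:R) 0 - normal_cdf x| <= D + d.
Proof.
move=> HD x.
have [k hk] : exists k, x < lattice k.
  exists (Num.truncn `|x * b + a|).+1.
  rewrite ltr_pdivlMr // ltrBrDr; apply: le_lt_trans (ler_norm _) _.
  exact: truncnS_gt.
case: (ex_minnP (ex_intro (fun k => x < lattice k) k hk)) => k0 xk0 kmin.
have ind j : (lattice j <= x) = (j < k0)%N.
  rewrite leNgt; apply/idP/idP => [|jk].
    by apply: contraNltn => kj; apply: (lt_le_trans xk0); rewrite lattice_le.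
  by apply/negP => /kmin; rewrite leqNgt jk.
have -> : (fun j => (lattice j <= x)%R%:R) = (fun j => (j < k0)%N%:R) :> (nat -> R).
  by apply/funext => j; rewrite ind.
rewrite -/(below k0); have := HD k0.
have xu : normal_cdf x <= normal_cdf (lattice k0) by apply: normal_cdf_nd; exact: ltW.
case: k0 xk0 kmin ind xu => [|k1] xk0 kmin ind xu.
  have -> : below 0 = 0.
    rewrite /below; have -> : (fun k => (k < 0)%N%:R) = fun=> 0 :> R by apply/funext => j; rewrite ltn0.
    by rewrite run_cst.
  have := normal_cdf_ge0 x; have := d0; rewrite !ler_norml => ? ? /andP[? ?].
  by apply/andP; split; lra.
have xl : lattice k1 <= x by rewrite ind.
have := @normal_cdf_lip R (lattice k1) (lattice k1.+1).
rewrite lattice_le // leqnSn => /(_ isT).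
rewrite -[X in lattice X - _](addn1 k1) lattice_shift mul1r addrAC subrr add0r => h.
have := normal_cdf_nd xl; have := d0; rewrite !ler_norml => ? ? /andP[? ?].
by apply/andP; split; lra.
Qed.

Section smoothing.
Variables (L : nat).
Hypothesis L0 : (0 < L)%N.

Let ramp k0 k : R := (minn L (k0 + L - k))%:R / L%:R.

Let LR : 0 < L%:R :> R. Proof. by rewrite ltr0n. Qed.

Let ramp_lip k0 k : `|fdiff (ramp k0) k| <= L%:R^-1.
Proof.
rewrite /fdiff /ramp -mulrBl normrM [X in _ * X]gtr0_norm ?invr_gt0 //.
rewrite ler_piMl ?invr_ge0 // distrC.
have -> : (minn L (k0 + L - k))%:R - (minn L (k0 + L - k.+1))%:R =
  (minn L (k0 + L - k) - minn L (k0 + L - k.+1))%:R :> R by rewrite natrB // minn_subnS_le.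
by rewrite normr_nat -[leRHS]/(1%:R) ler_nat minn_subnS_close.
Qed.

Let ramp_ge k0 k : (k < k0)%N%:R <= ramp k0 k.
Proof.
rewrite ler_pdivlMr //; case: ltnP => kk; last by rewrite mul0r.
by rewrite mul1r ler_nat leq_minn_sub.
Qed.

Let ramp_le k0 k : ramp k0 k <= (k < k0 + L)%N%:R.
Proof.
rewrite ler_pdivrMr //; case: ltnP => kk; first by rewrite mul1r ler_nat geq_minl.
have -> : (k0 + L - k = 0)%N by apply/eqP; rewrite subn_eq0.
by rewrite minn0 mul0r.
Qed.

Let spliced_mono i g h : (forall k, g k <= h k) -> spliced n i g <= spliced n i h.
Proof.
move=> gh; apply: run_mono => // k ki; apply: run_mono => //; exact: leqW.
Qed.

Let spliced_ramp i k0 : (i < n)%N ->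
  `|spliced n i (ramp k0) - run theta 0 n (ramp k0) 0| <= mc / L%:R.
Proof.
move=> ni.
have := spliced_close alpha01 theta0 rn ni (leqnn n) (lexx 0) (ramp_lip k0)
  (fun j => _ : `|fdiff (fun=> L%:R^-1) j| <= 0).
by rewrite run_cst addr0; apply => j; rewrite /fdiff subrr normr0.
Qed.

(** The ramp equal to 1 below j and to 0 from j + L on is Lipschitz with constant
    1 / L and lies between the two indicators. *)
Lemma below_le_spliced i j : (i < n)%N ->
  below j <= spliced n i (fun k => (k < j + L)%N%:R) + mc / L%:R.
Proof.
move=> ni; have := spliced_ramp j ni; rewrite ler_norml => /andP[h _].
have h1 : below j <= run theta 0 n (ramp j) 0 by apply: run_mono.
have h2 : spliced n i (ramp j) <= spliced n i (fun k => (k < j + L)%N%:R) by exact: spliced_mono.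
lra.
Qed.

Lemma spliced_le_below i j : (i < n)%N ->
  spliced n i (fun k => (k < j)%N%:R) <= below (j + L) + mc / L%:R.
Proof.
move=> ni; have := spliced_ramp j ni; rewrite ler_norml => /andP[_ h].
have h1 : run theta 0 n (ramp j) 0 <= below (j + L) by apply: run_mono.
have h2 : spliced n i (fun k => (k < j)%N%:R) <= spliced n i (ramp j) by exact: spliced_mono.
lra.
Qed.

End smoothing.

Lemma kolmogorov_smooth (L : nat) x : (0 < L)%N ->
  `|run theta 0 n (fun k => (lattice k <= x)%R%:R) 0 - normal_cdf x| <=
  (lattice_cst + c2 / s ^+ 2) / S + L%:R * d + (1 + c2 / s ^+ 2) * (mc / L%:R) + d.
Proof.
move=> L0; apply: run_cdf => k0; apply: below_normal_cdf.
- by rewrite divr_ge0.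
- by move=> i j; exact: below_le_spliced.
- by move=> i j; exact: spliced_le_below.
Qed.

Section alpha_eq0.
Hypothesis alpha0 : alpha = 0.

Let antitone k0 k : fdiff (fun j => (j < k0)%N%:R) k <= 0 :> R.
Proof. by rewrite subr_le0 ler_nat; case: (ltnP k.+1 k0) => // /ltnW ->. Qed.

Let run_antitone m l k0 k : (k <= m)%N ->
  fdiff (run theta m l (fun j => (j < k0)%N%:R)) k <= 0.
Proof.
move=> km; rewrite fdiff_run //= mulr_ge0_le0 //.
  by apply: le_trans (growths_ge1 alpha01 theta0 _ _).
exact: run_le_cst.
Qed.

(** For alpha = 0 the increments are independent of the state. *)
Let run_succ m l g k : run theta m l g k.+1 = run theta m l (fun j => g j.+1) k.
Proof.
elim: l m k => [//|l IH] m k /=.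
by rewrite /step !IH /new_table alpha0 !mul0r.
Qed.

Let belowE i k0 : (i < n)%N ->
  below k0 = run theta 0 i (step alpha theta i (run theta i.+1 (n - i.+1) (fun k => (k < k0)%N%:R))) 0.
Proof.
move=> ni; rewrite /below [in LHS](_ : n = i + (n - i.+1).+1)%N ?run_add //.
by rewrite subnSK // subnKC // ltnW.
Qed.

Let splicedE i g : spliced n i g = run theta 0 i (run theta i.+1 (n - i.+1) g) 0.
Proof. by rewrite /spliced [X in _ + X]alpha0 addr0. Qed.

(** A transition cannot decrease the count. *)
Lemma below_le_spliced0 i j : (i < n)%N ->
  below j <= spliced n i (fun k => (k < j + 1)%N%:R) + 0.
Proof.
move=> ni; rewrite addr0 (belowE _ ni) splicedE; apply: run_mono => // k ki.
rewrite step_shift.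
have /andP[p0 p1] := new_table01 alpha01 theta0 ki.
apply: le_trans (_ : run theta i.+1 (n - i.+1) (fun k => (k < j)%N%:R) k <= _).
  by rewrite gerDl mulr_ge0_le0 // run_antitone // leqW.
apply: run_mono => //; last exact: leqW.
by move=> u _; rewrite ler_nat addn1; case: ltnP => // /ltnW; rewrite ltnS => ->.
Qed.

(** A transition increases the count by at most one, and for alpha = 0 the later
    transitions commute with this shift. *)
Lemma spliced_le_below0 i j : (i < n)%N ->
  spliced n i (fun k => (k < j)%N%:R) <= below (j + 1) + 0.
Proof.
move=> ni; rewrite addr0 (belowE _ ni) splicedE; apply: run_mono => // k ki.
have /andP[p0 p1] := new_table01 alpha01 theta0 ki.
set h := run theta i.+1 _ (fun k => (k < j + 1)%N%:R).
have -> : run theta i.+1 (n - i.+1) (fun k => (k < j)%N%:R) k = h k.+1.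
  by rewrite /h run_succ addn1.
have : fdiff h k <= 0 by apply: run_antitone; exact: leqW.
by rewrite /step /fdiff; nra.
Qed.

(** The counts of the chain and of the spliced chain differ by at most one, in
    the sense of stochastic order, so they are compared exactly up to one lattice
    step. *)
Lemma kolmogorov_alpha0 x :
  `|run theta 0 n (fun k => (lattice k <= x)%R%:R) 0 - normal_cdf x| <=
  (lattice_cst + c2 / s ^+ 2) / S + 2 * d.
Proof.
have -> : (lattice_cst + c2 / s ^+ 2) / S + 2 * d =
  (lattice_cst + c2 / s ^+ 2) / S + 1%:R * d + (1 + c2 / s ^+ 2) * 0 + d by ring.
apply: run_cdf => k0; apply: below_normal_cdf => //.
- by move=> i j; exact: below_le_spliced0.
- by move=> i j; exact: spliced_le_below0.
Qed.

End alpha_eq0.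

End kolmogorov.

(** * Elementary inequalities for the moments *)

Section elementary.
Variable R : realType.
Implicit Types x y u lambda theta : R.

Lemma ln_leB1 x : 0 < x -> ln x <= x - 1.
Proof. by move=> x0; have := @le_ln1Dx _ (x - 1); rewrite subrKC; apply; lra. Qed.

Lemma ln_ltB1 x : 0 < x -> x != 1 -> ln x < x - 1.
Proof.
move=> x0 x1; have := @expR_gt1Dx _ (ln x); rewrite ln_eq0 // lnK ?posrE //.
by move=> /(_ x1); lra.
Qed.

Lemma ln_ge1V u : 0 < u -> u / (1 + u) <= ln (1 + u).
Proof.
move=> u0; have u1 : 0 < 1 + u by lra.
have := ln_leB1 (_ : 0 < (1 + u)^-1); rewrite invr_gt0 => /(_ u1).
rewrite lnV ?posrE //; have -> : u / (1 + u) = 1 - (1 + u)^-1 by field; rewrite gt_eqF.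
lra.
Qed.

(** Concavity of the logarithm: the tangent inequality at t = 1 + alpha (y - 1),
    averaged over the points y and 1 with weights alpha and 1 - alpha. *)
Lemma bernoulli alpha y : 0 <= alpha <= 1 -> 0 < y -> y `^ alpha <= 1 + alpha * (y - 1).
Proof.
move=> /andP[a0 a1] y0; set t := 1 + _.
have t0 : 0 < t by rewrite /t; nra.
rewrite -ler_ln ?posrE ?powR_gt0 // ln_powR.
have := ln_leB1 (divr_gt0 y0 t0); rewrite ln_div ?posrE // => h1.
have := ln_leB1 (_ : 0 < t^-1); rewrite invr_gt0 lnV ?posrE // => /(_ t0) h2.
have e : alpha * (y / t - 1) + (1 - alpha) * (t^-1 - 1) = 0.
  by rewrite /t; field; rewrite gt_eqF.
nra.
Qed.

Lemma bernoulli_lt alpha y : 0 < alpha < 1 -> 0 < y -> y != 1 ->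
  y `^ alpha < 1 + alpha * (y - 1).
Proof.
move=> /andP[a0 a1] y0 y1; set t := 1 + _.
have t0 : 0 < t by rewrite /t; nra.
rewrite -ltr_ln ?posrE ?powR_gt0 // ln_powR.
have := ln_leB1 (divr_gt0 y0 t0); rewrite ln_div ?posrE // => h1.
have t1 : t^-1 != 1.
  rewrite invr_eq1 /t -subr_eq0 addrAC subrr add0r.
  by rewrite mulf_neq0 ?subr_eq0 // lt0r_neq0.
have := ln_ltB1 (_ : 0 < t^-1) t1; rewrite invr_gt0 lnV ?posrE // => /(_ t0) h2.
have e : alpha * (y / t - 1) + (1 - alpha) * (t^-1 - 1) = 0.
  by rewrite /t; field; rewrite gt_eqF.
nra.
Qed.

(** The lower bound on the power is [bernoulli] at 1 / (1 + u). *)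
Lemma growth_powR alpha u : 0 <= alpha <= 1 -> 0 < u ->
  (1 + u) `^ alpha <= 1 + alpha * u <= (1 + u) `^ alpha * (1 + u ^+ 2).
Proof.
move=> a01 u0; have u1 : 0 < 1 + u by lra.
apply/andP; split; first by have := bernoulli a01 u1; rewrite addrAC subrr add0r.
case/andP: (a01) => a0 a1.
have := bernoulli a01 (_ : 0 < (1 + u)^-1); rewrite invr_gt0 => /(_ u1).
set p := (1 + u) `^ alpha; have p0 : 0 < p by rewrite powR_gt0.
have -> : (1 + u)^-1 `^ alpha = p^-1.
  by rewrite -powR_inv1 ?ltW // -powRrM mulrC powRrM powR_inv1 // ltW.
have -> : 1 + alpha * ((1 + u)^-1 - 1) = (1 + u - alpha * u) / (1 + u).
  by field; rewrite gt_eqF.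
have q0 : 0 < 1 + u - alpha * u by nra.
rewrite ler_pdivlMr // mulrC ler_pdivrMr // => h.
have au : 0 <= alpha * u <= u by apply/andP; split; nra.
apply: le_trans (_ : (1 + u) / (1 + u - alpha * u) * (1 + u ^+ 2) <= _); last first.
  by rewrite ler_wpM2r ?addr_ge0 ?sqr_ge0 // ler_pdivrMr // mulrC.
rewrite mulrAC ler_pdivlMr // expr2.
have : 0 <= u * u * u by rewrite !mulr_ge0 // ltW.
have : 0 <= alpha * u * (alpha * u) by rewrite mulr_ge0; case/andP: au.
have : alpha * u * u <= u * u by rewrite ler_pM2r //; case/andP: au.
lra.
Qed.

(** The logarithm telescopes, and u - ln(1 + u) lies between 0 and u^2. *)
Lemma sum_inv theta n : 0 < theta ->
  `|\sum_(j < n) (theta + j%:R)^-1 - (ln (theta + n%:R) - ln theta)| <= n%:R / theta ^+ 2.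
Proof.
move=> t0; elim: n => [|n IH]; first by rewrite big_ord0 addr0 subrr subr0 normr0 mul0r.
rewrite big_ord_recr /=; have tn := thetaDn_gt0 n t0.
set u := (theta + n%:R)^-1.
have u0 : 0 < u by rewrite invr_gt0.
have E : ln (theta + n.+1%:R) = ln (theta + n%:R) + ln (1 + u).
  rewrite -lnM ?posrE //; last by lra.
  by rewrite mulrDr mulr1 divff ?gt_eqF // -natr1 addrA.
have -> : \sum_(i < n) (theta + i%:R)^-1 + u - (ln (theta + n.+1%:R) - ln theta) =
  (\sum_(i < n) (theta + i%:R)^-1 - (ln (theta + n%:R) - ln theta)) + (u - ln (1 + u)).
  by rewrite E; ring.
apply: le_trans (ler_normD _ _) _; rewrite -natr1 mulrDl mul1r lerD //.
have h1 : ln (1 + u) <= u by apply: le_ln1Dx; lra.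
rewrite ger0_norm ?subr_ge0 //.
apply: le_trans (_ : u ^+ 2 <= _).
  have := ln_ge1V u0; have -> : u / (1 + u) = u - u ^+ 2 / (1 + u).
    by field; rewrite gt_eqF //; lra.
  have : u ^+ 2 / (1 + u) <= u ^+ 2.
    by rewrite ler_pdivrMr ?ler_peMr ?sqr_ge0 //; lra.
  lra.
have ut : u <= theta^-1 := invDn_le t0 n.
by rewrite -[leRHS]exprVn lerXn2r ?nnegrE ?invr_ge0 ?(ltW t0) ?(ltW tn).
Qed.

(** Compared with the telescoping sum of 1 / (x (x + 1)), each term is off by at
    most 1 / x^3, whatever the shift beta in [0, 1]. *)
Lemma sum_inv2 theta beta n : 0 < theta -> 0 <= beta <= 1 ->
  `|\sum_(j < n) ((theta + j%:R + beta) ^+ 2)^-1 - (theta^-1 - (theta + n%:R)^-1)|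
   <= n%:R / theta ^+ 3.
Proof.
move=> t0 /andP[b0 b1]; elim: n => [|n IH].
  by rewrite big_ord0 addr0 subrr subr0 normr0 mul0r.
rewrite big_ord_recr /=; have tn := thetaDn_gt0 n t0.
set x := theta + n%:R in tn *.
have xt : theta <= x by rewrite /x lerDl.
have E : (theta + n.+1%:R)^-1 = x^-1 - (x * (x + 1))^-1.
  rewrite -natr1 addrA -/x; field; rewrite (gt_eqF tn) gt_eqF //; lra.
have xb : 0 < x + beta by lra.
have x1 : 0 < x + 1 by lra.
rewrite E; set q := ((x + beta) ^+ 2)^-1.
have -> : \sum_(i < n) ((theta + i%:R + beta) ^+ 2)^-1 + q - (theta^-1 - (x^-1 - (x * (x + 1))^-1)) =
  (\sum_(i < n) ((theta + i%:R + beta) ^+ 2)^-1 - (theta^-1 - x^-1)) + (q - (x * (x + 1))^-1) by ring.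
have -> : n.+1%:R / theta ^+ 3 = n%:R / theta ^+ 3 + (theta ^+ 3)^-1.
  by rewrite -natr1; ring.
apply: le_trans (ler_normD _ _) _; rewrite lerD //.
apply: le_trans (_ : (x ^+ 3)^-1 <= _); last first.
  by rewrite lef_pV2 ?posrE ?exprn_gt0 // ler_pXn2r // nnegrE ltW.
have -> : q - (x * (x + 1))^-1 = (x * (1 - 2 * beta) - beta ^+ 2) / (x + 1) * (x * (x + beta) ^+ 2)^-1.
  by rewrite /q; field; rewrite (gt_eqF tn) !gt_eqF.
have Q0 : 0 <= (x * (x + beta) ^+ 2)^-1.
  by rewrite invr_ge0 mulr_ge0 ?sqr_ge0 // ltW.
rewrite normrM (ger0_norm Q0).
apply: le_trans (_ : (x * (x + beta) ^+ 2)^-1 <= _).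
  apply: ler_piMl => //.
  rewrite normrM [X in _ * X]gtr0_norm ?invr_gt0 // ler_pdivrMr // mul1r.
  have bb : 0 <= beta * beta <= 1 by apply/andP; split; nra.
  have xb0 : 0 <= x * beta <= x by apply/andP; split; nra.
  move: bb xb0 => /andP[? ?] /andP[? ?]; rewrite expr2.
  by rewrite ler_norml; apply/andP; split; lra.
rewrite lef_pV2 ?posrE ?mulr_gt0 ?exprn_gt0 // (exprS x 2) ler_pM2l //.
by rewrite ler_pXn2r ?nnegrE ?(ltW tn) ?(ltW xb) // lerDl.
Qed.

(** Bonferroni's bounds, with the square of the sum in place of the sum over pairs. *)
Lemma prod_sub1_approx (a : nat -> R) n : (forall j, 0 <= a j <= 1) ->
  let P := \prod_(j < n) (1 - a j) in let T := \sum_(j < n) a j in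
  [/\ 0 <= P, P <= 1, 1 - T <= P, P <= 1 - T + T ^+ 2 & 0 <= T].
Proof.
move=> a01 /=; elim: n => [|n [P0 P1 TP PT T0]].
  by rewrite !big_ord0; split => //; rewrite ?subr0 ?expr0n ?addr0.
have /andP[a0 a1] := a01 n; rewrite !big_ord_recr /=.
set P := \prod_(_ < _) _ in P0 P1 TP PT *; set T := \sum_(_ < _) _ in TP PT T0 *.
have aT : 0 <= a n * T by rewrite mulr_ge0.
split.
- by rewrite mulr_ge0 // subr_ge0.
- by rewrite mulr_ile1 ?subr_ge0 // gerBl.
- nra.
- have : a n * (1 - T) <= a n * P by rewrite ler_wpM2l.
  have : 0 <= a n * a n by rewrite mulr_ge0.
  move: PT; rewrite !expr2; lra.
- exact: addr_ge0.
Qed.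

(** Equivalent to exp(- x) >= 1 - x. *)
Lemma expR_sub1_le x : 0 <= x -> expR x - 1 <= x * expR x.
Proof.
move=> x0; have := expR_ge1Dx (- x); rewrite expRN => h.
have e0 := expR_gt0 x.
have : (1 - x) * expR x <= (expR x)^-1 * expR x by rewrite ler_pM2r.
by rewrite mulVf ?gt_eqF //; lra.
Qed.

End elementary.

(** * Mean and var_tables of the number of tables *)

Section positivity.
Variable R : realType.
Implicit Types lambda alpha : R.

(** With r = 1 + 1 / lambda, the claim for alpha > 0 is
    r^(- alpha) < 1 - alpha (1 - 1 / r), the strict Bernoulli inequality at 1 / r. *)
Lemma var_const_gt0 lambda alpha : 0 < lambda -> 0 <= alpha < 1 ->
  0 < var_const lambda alpha.
Proof.
move=> l0 /andP[a0 a1]; have l1 : 0 < 1 + lambda by lra.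
have ln0 : lambda != 0 by rewrite gt_eqF.
set r := 1 + lambda^-1; have r0 : 0 < r by rewrite addr_gt0 ?invr_gt0.
have rV : r^-1 = lambda / (1 + lambda).
  by rewrite /r; field; rewrite ln0 gt_eqF //; lra.
have rV0 : 0 < r^-1 by rewrite invr_gt0.
have rV1 : r^-1 != 1.
  rewrite rV -subr_eq0 (_ : _ - 1 = - (1 + lambda)^-1) ?oppr_eq0 ?invr_eq0 ?gt_eqF //.
  by field; rewrite gt_eqF.
rewrite /var_const -/r; case: eqVneq => [_|an].
  have := ln_ltB1 rV0 rV1; rewrite lnV ?posrE // rV => h.
  have -> : lambda * ln r - lambda / (1 + lambda) = lambda * (ln r - (1 + lambda)^-1) by ring.
  rewrite mulr_gt0 // subr_gt0.
  have e : lambda / (1 + lambda) - 1 = - (1 + lambda)^-1 by field; rewrite gt_eqF.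
  by lra.
have a00 : 0 < alpha by rewrite lt_neqAle eq_sym an.
have a01 : 0 < alpha < 1 by rewrite a00.
have := bernoulli_lt a01 rV0 rV1.
rewrite [2 * alpha]mulrC powRrM powR_mulrn ?powR_ge0 //.
have -> : r^-1 `^ alpha = (r `^ alpha)^-1.
  by rewrite -powR_inv1 ?ltW // -powRrM mulrC powRrM powR_inv1 // powR_ge0.
set p := r `^ alpha; have p0 : 0 < p by rewrite powR_gt0.
have -> : 1 + alpha * (r^-1 - 1) = 1 - alpha / (1 + lambda).
  by rewrite rV; field; rewrite gt_eqF.
rewrite -(ltr_pM2l p0) divff ?gt_eqF // => h.
rewrite mulr_gt0 ?divr_gt0 //.
have -> : p ^+ 2 * (1 - alpha / (1 + lambda)) - p = p * (p * (1 - alpha / (1 + lambda)) - 1) by ring.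
by rewrite mulr_gt0 // subr_gt0.
Qed.
End positivity.

Section moments.
Variables (R : realType) (alpha theta : R).
Hypothesis theta0 : 0 < theta.
Local Notation run := (run alpha).
Local Notation mean_tables := (mean_tables alpha theta).
Local Notation var_tables := (var_tables alpha theta).
Local Notation growths := (growths alpha).

(** An eigenfunction of the transitions, which yields the mean. *)
Lemma run_table m l k :
  run theta m l (fun j => theta + alpha * j%:R) k = growths theta m l * (theta + alpha * k%:R).
Proof.
elim: l m k => [|l IH] m k; first by rewrite growths0 mul1r.
rewrite runS_r growthsS_r.
have -> : step alpha theta (m + l) (fun j => theta + alpha * j%:R) =
  growth alpha theta (m + l) \*o (fun j => theta + alpha * j%:R).
  apply/funext => j; rewrite /= /step /growth /new_table -natr1.
  have := thetaDn_gt0 (m + l) theta0; move: ((m + l)%:R : R) => x h.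
  by field; rewrite gt_eqF.
by rewrite runZ /= IH; ring.
Qed.

(** A second eigenfunction, which yields the variance. *)
Lemma run_table2 m l k :
  run theta m l (fun j => (theta + alpha * j%:R) * (theta + alpha + alpha * j%:R)) k =
  (\prod_(i < l) (1 + 2 * alpha / (theta + (m + i)%:R))) *
    ((theta + alpha * k%:R) * (theta + alpha + alpha * k%:R)).
Proof.
elim: l m k => [|l IH] m k; first by rewrite big_ord0 mul1r.
rewrite runS_r big_ord_recr /=; set g := fun j => _ * _.
have -> : step alpha theta (m + l) g =
  (1 + 2 * alpha / (theta + (m + l)%:R)) \*o g.
  apply/funext => j; rewrite /= /g /step /new_table -natr1.
  have := thetaDn_gt0 (m + l) theta0; move: ((m + l)%:R : R) => x h.
  by field; rewrite gt_eqF.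
by rewrite runZ /= IH; ring.
Qed.

Lemma mean_tablesE n : theta + alpha * mean_tables n = theta * growths theta 0 n.
Proof.
have := run_table 0 n 0; rewrite mulr0 addr0 [RHS]mulrC => <-.
have -> : (fun j => theta + alpha * j%:R) = (fun j => alpha * j%:R + theta) :> (nat -> R).
  by apply/funext => j; rewrite addrC.
by rewrite run_affine addrC.
Qed.

Lemma var_tablesM n : alpha ^+ 2 * var_tables n =
  theta * (theta + alpha) * \prod_(i < n) (1 + 2 * alpha / (theta + (0 + i)%:R))
  - alpha * theta * growths theta 0 n - theta ^+ 2 * growths theta 0 n ^+ 2.
Proof.
have -> : alpha ^+ 2 * var_tables n = run theta 0 n (fun k => (theta + alpha * k%:R) * (theta + alpha + alpha * k%:R)) 0
   + (-1 * ((2 * (theta * growths theta 0 n) + alpha) * run theta 0 n (fun k => theta + alpha * k%:R) 0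
           + - (theta * growths theta 0 n) ^+ 2)).
  rewrite -[alpha ^+ 2 * _]/((alpha ^+ 2 \*o run theta 0 n _) 0) -runZ.
  rewrite -run_affine -[-1 * _]/((-1 \*o run theta 0 n _) 0) -runZ.
  rewrite -[RHS]/((run theta 0 n _ \+ run theta 0 n _) 0) -runD.
  congr (run _ _ _ _ _); apply/funext => k /=.
  have -> : theta * growths theta 0 n = theta + alpha * mean_tables n by rewrite mean_tablesE.
  by ring.
by rewrite run_table run_table2 !mulr0 !addr0; ring.
Qed.

End moments.

Section moments_ge0.
Variables (R : realType) (alpha theta : R).
Hypotheses (alpha01 : 0 <= alpha < 1) (theta0 : 0 < theta).
Local Notation growths := (growths alpha).

Let a0 : 0 <= alpha. Proof. by case/andP: alpha01. Qed.
Let a1 : alpha <= 1. Proof. by case/andP: alpha01 => _ /ltW. Qed.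

(** The second moment is the square of the first one up to the last product, which
    is 1 - O(1 / n).  The leading terms of order n^2 cancel in the variance, so
    this product is what decides it. *)
Lemma prod_double n : \prod_(i < n) (1 + 2 * alpha / (theta + (0 + i)%:R)) =
  growths theta 0 n ^+ 2 * \prod_(i < n) (1 - alpha ^+ 2 / (theta + i%:R + alpha) ^+ 2).
Proof.
rewrite expr2 -!big_split /=; apply: eq_bigr => i _; rewrite add0n /growth.
have h := thetaDn_gt0 i theta0.
have h' : 0 < theta + i%:R + alpha by have := a0; lra.
by field; rewrite !gt_eqF.
Qed.

(** By [growth_powR] at each u = 1 / (theta + j); the powers telescope. *)
Lemma growths_powR n :
  ((theta + n%:R) / theta) `^ alpha <= growths theta 0 n
    <= ((theta + n%:R) / theta) `^ alpha * (1 + (theta ^+ 2)^-1) ^+ n.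
Proof.
elim: n => [|n /andP[IH1 IH2]].
  by rewrite growths0 addr0 divff ?gt_eqF // powR1 expr0 mulr1 lexx.
have tn := thetaDn_gt0 n theta0.
set u := (theta + n%:R)^-1; have u0 : 0 < u by rewrite invr_gt0.
have -> : (theta + n.+1%:R) / theta = (theta + n%:R) / theta * (1 + u).
  by rewrite -natr1 /u; field; rewrite !gt_eqF.
rewrite powRM ?divr_ge0 ?(ltW tn) ?(ltW theta0) //; last by lra.
have a01 : 0 <= alpha <= 1 by rewrite a0 a1.
have /andP[g1 g2] := growth_powR a01 u0.
rewrite growthsS_r add0n; have G1 := growth_ge1 alpha01 theta0 n.
have e : growth alpha theta n = 1 + alpha * u by [].
set p := _ `^ alpha in IH1 IH2 *; set q := _ `^ alpha in g1 g2 *.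
have q0 : 0 <= q by exact: powR_ge0.
have p0 : 0 <= p by exact: powR_ge0.
apply/andP; split; first by rewrite ler_pM // e.
rewrite exprS; apply: le_trans (_ : p * (1 + (theta ^+ 2)^-1) ^+ n * (q * (1 + u ^+ 2)) <= _).
  rewrite ler_pM ?e //; last by have := G1; rewrite e; lra.
  by apply: le_trans (growths_ge1 alpha01 theta0 _ _).
have -> : p * (1 + (theta ^+ 2)^-1) ^+ n * (q * (1 + u ^+ 2)) =
  p * q * ((1 + u ^+ 2) * (1 + (theta ^+ 2)^-1) ^+ n) by ring.
have t20 : 0 <= (theta ^+ 2)^-1 by rewrite invr_ge0 sqr_ge0.
rewrite ler_wpM2l ?mulr_ge0 // ler_wpM2r ?exprn_ge0 ?addr_ge0 // lerD2l.
have ut : u <= theta^-1 := invDn_le theta0 n.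
by rewrite -[leRHS]exprVn lerXn2r ?nnegrE ?invr_ge0 ?(ltW theta0) ?(ltW tn).
Qed.

(** [prod_sub1_approx] for terms of order n^(-2), whose sum is given by [sum_inv2]. *)
Lemma prod_sq n :
  let P := \prod_(i < n) (1 - alpha ^+ 2 / (theta + i%:R + alpha) ^+ 2) in
  [/\ 0 <= P, P <= 1, 1 - P <= n%:R / theta ^+ 2
    & `|P - 1 + alpha ^+ 2 * (theta^-1 - (theta + n%:R)^-1)| <=
        n%:R / theta ^+ 3 + (n%:R / theta ^+ 2) ^+ 2].
Proof.
pose a j := alpha ^+ 2 / (theta + j%:R + alpha) ^+ 2.
have aE j : a j = alpha ^+ 2 * ((theta + j%:R + alpha) ^+ 2)^-1 by [].
have asq : 0 <= alpha ^+ 2 <= 1 by rewrite sqr_ge0 expr_le1.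
case/andP: (asq) => as0 as1.
have pos j : 0 < theta + j%:R + alpha by have := thetaDn_gt0 j theta0; have := a0; lra.
have at2 j : a j <= (theta ^+ 2)^-1.
  rewrite aE; apply: le_trans (_ : ((theta + j%:R + alpha) ^+ 2)^-1 <= _).
    by rewrite ler_piMl // invr_ge0 sqr_ge0.
  rewrite lef_pV2 ?posrE ?exprn_gt0 // lerXn2r ?nnegrE ?(ltW theta0) ?(ltW (pos j)) //.
  by rewrite -addrA lerDl addr_ge0.
have aj j : 0 <= a j <= 1.
  apply/andP; split; first by rewrite divr_ge0 // sqr_ge0.
  rewrite ler_pdivrMr ?exprn_gt0 // mul1r lerXn2r ?nnegrE ?(ltW (pos j)) //.
  by rewrite lerDr ltW // thetaDn_gt0.
have /= [P0 P1 TP PT T0] := prod_sub1_approx n aj.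
set P := \prod_(_ < _) _; rewrite -/P in P0 P1 TP PT.
set T := \sum_(_ < _) _ in TP PT T0.
have Tn : T <= n%:R / theta ^+ 2.
  apply: le_trans (_ : \sum_(j < n) (theta ^+ 2)^-1 <= _); first exact: ler_sum.
  by rewrite sumr_const card_ord -[leLHS]mulr_natl.
have TB : `|T - alpha ^+ 2 * (theta^-1 - (theta + n%:R)^-1)| <= n%:R / theta ^+ 3.
  have a01 : 0 <= alpha <= 1 by rewrite a0 a1.
  have -> : T = alpha ^+ 2 * \sum_(j < n) ((theta + j%:R + alpha) ^+ 2)^-1.
    by rewrite mulr_sumr.
  rewrite -mulrBr normrM ger0_norm //.
  apply: le_trans (_ : 1 * (n%:R / theta ^+ 3) <= _); last by rewrite mul1r.
  by rewrite ler_pM // sum_inv2.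
have T2 : T ^+ 2 <= (n%:R / theta ^+ 2) ^+ 2.
  by rewrite lerXn2r ?nnegrE ?divr_ge0 ?sqr_ge0.
split=> //; first by lra.
move: TB; rewrite !ler_norml => /andP[? ?]; have := sqr_ge0 T.
by move=> ?; apply/andP; split; lra.
Qed.

End moments_ge0.

Section moment_asymptotics.
Variables (R : realType) (lambda alpha : R).
Hypotheses (lambda0 : 0 < lambda) (alpha01 : 0 <= alpha < 1).
Local Notation theta n := (lambda * n%:R).

Let t0 n : (0 < n)%N -> 0 < theta n.
Proof. by move=> n0; rewrite mulr_gt0 // ltr0n. Qed.
Let ln0 : lambda != 0. Proof. by rewrite gt_eqF. Qed.
Let l1 : 1 + lambda != 0. Proof. by rewrite gt_eqF // addr_gt0. Qed.
Let nn0 n : (0 < n)%N -> n%:R != 0 :> R. Proof. by rewrite pnatr_eq0; case: n. Qed.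

Let ratioE n : (0 < n)%N -> (theta n + n%:R) / theta n = 1 + lambda^-1.
Proof. by move=> n0; field; rewrite ?nn0 ?ln0. Qed.

(** For alpha = 0 the count is a sum of independent indicators. *)
Lemma moments_alpha0 n : (0 < n)%N -> alpha = 0 ->
  `|mean_tables alpha (theta n) n - n%:R * mean_const lambda alpha| <= lambda^-1 /\
  `|var_tables alpha (theta n) n - n%:R * var_const lambda alpha| <= 2 * lambda^-1.
Proof.
move=> n0 a0; have tn := t0 n0.
have mE m : mean_tables alpha (theta n) m = theta n * \sum_(j < m) (theta n + j%:R)^-1.
  elim: m => [|m IH]; first by rewrite big_ord0 mulr0.
  by rewrite mean_tables_rec IH big_ord_recr /= /new_table a0 mul0r addr0 mulrDr.
have vE : var_tables alpha (theta n) n = theta n * \sum_(j < n) (theta n + j%:R)^-1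
   - theta n ^+ 2 * \sum_(j < n) ((theta n + j%:R + 0) ^+ 2)^-1.
  rewrite var_tablesE // !mulr_sumr -sumrB; apply: eq_bigr => i _.
  rewrite /step_weight /growths big1 ?expr1n ?mul1r; last first.
    by move=> j _; rewrite /growth a0 mul0r addr0.
  rewrite /mean_step_var (_ : (fun k => _) = fun=> step_var alpha (theta n) i 0); last first.
    by apply/funext => k; rewrite /step_var /new_table a0 !mul0r.
  rewrite run_cst /step_var /new_table a0 mul0r !addr0.
  have h : 0 < theta n + i%:R := thetaDn_gt0 i tn.
  by field; rewrite gt_eqF.
have lnE : ln (theta n + n%:R) - ln (theta n) = ln (1 + lambda^-1).
  by rewrite -ln_div ?posrE ?thetaDn_gt0 // ratioE.
have S1 : `|theta n * \sum_(j < n) (theta n + j%:R)^-1 - theta n * ln (1 + lambda^-1)| <= lambda^-1.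
  rewrite -mulrBr -lnE normrM gtr0_norm //.
  apply: le_trans (ler_wpM2l (ltW tn) (sum_inv n tn)) _.
  by rewrite le_eqVlt; apply/orP; left; apply/eqP; field; rewrite ?nn0 ?ln0.
rewrite mE vE /mean_const /var_const a0 eqxx.
have -> : n%:R * (lambda * ln (1 + lambda^-1)) = theta n * ln (1 + lambda^-1) by ring.
split=> //.
have b01 : 0 <= (0 : R) <= 1 by rewrite lexx ler01.
have S2 : `|theta n ^+ 2 * \sum_(j < n) ((theta n + j%:R + 0) ^+ 2)^-1 - n%:R * (lambda / (1 + lambda))| <= lambda^-1.
  have -> : n%:R * (lambda / (1 + lambda)) = theta n ^+ 2 * ((theta n)^-1 - (theta n + n%:R)^-1).
    field; rewrite l1 ln0 nn0 //= gt_eqF //; exact: thetaDn_gt0.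
  rewrite -mulrBr normrM ger0_norm ?sqr_ge0 //.
  apply: le_trans (ler_wpM2l (sqr_ge0 _) (sum_inv2 n tn b01)) _.
  by rewrite le_eqVlt; apply/orP; left; apply/eqP; field; rewrite ?nn0 ?ln0.
move: S1 S2; rewrite !ler_norml => /andP[? ?] /andP[? ?].
by apply/andP; split; lra.
Qed.

(** For alpha > 0 the variance is a difference of terms of order n^2.  Written
    through [prod_double], it only involves n (P - rho) and
    n^2 (Q - 1 + alpha^2 / (theta (1 + lambda))), which are both bounded; here P is
    [growths], rho is its limit (1 + 1 / lambda)^alpha and Q is the product in
    [prod_double]. *)
Lemma moments_bounded : exists c1 c2 : R, forall n, (0 < n)%N ->
  `|mean_tables alpha (theta n) n - n%:R * mean_const lambda alpha| <= c1 /\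
  `|var_tables alpha (theta n) n - n%:R * var_const lambda alpha| <= c2.
Proof.
case: (eqVneq alpha 0) => [a0|an].
  by exists lambda^-1, (2 * lambda^-1) => n n0; apply: moments_alpha0.
have a0 : 0 <= alpha by case/andP: alpha01.
have ap : 0 < alpha by rewrite lt_neqAle eq_sym an.
pose rho := (1 + lambda^-1) `^ alpha.
have rho0 : 0 < rho by rewrite powR_gt0 // addr_gt0 ?invr_gt0.
pose e := (lambda ^+ 2)^-1; have e0 : 0 <= e by rewrite invr_ge0 sqr_ge0.
(* D bounds n (P - rho), where P <= rho (1 + e / n^2)^n <= rho exp(e / n). *)
pose D := rho * (e * expR e); have D0 : 0 <= D by rewrite !mulr_ge0 ?expR_ge0 // ltW.
pose M := rho + D.
have M0 : 0 <= M by rewrite addr_ge0 // ltW.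
pose c := lambda ^+ 2 * M ^+ 2 * ((lambda ^+ 3)^-1 + e ^+ 2)
  + lambda * alpha ^+ 2 / (1 + lambda) * (D * (M + rho))
  + alpha * lambda * (M ^+ 2 * e) + alpha * lambda * (D * (M + rho)) + alpha * lambda * D.
exists (lambda / alpha * D), (c / alpha ^+ 2) => n n0; have tn := t0 n0.
set P := growths alpha (theta n) 0 n.
have nR : 0 < n%:R :> R by rewrite ltr0n.
have nR1 : n%:R^-1 <= 1 :> R by rewrite invf_le1 // ler1n.
have P1 : rho <= P by case/andP: (growths_powR alpha01 tn n); rewrite ratioE.
have en : n%:R * (theta n ^+ 2)^-1 = e / n%:R.
  by rewrite /e; field; rewrite ?nn0 ?ln0.
have PD : n%:R * (P - rho) <= D.
  case/andP: (growths_powR alpha01 tn n); rewrite ratioE // -/rho => _ h.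
  have h2 : (1 + (theta n ^+ 2)^-1) ^+ n <= expR (e / n%:R).
    by rewrite -en expRM_natl lerXn2r ?nnegrE ?expR_ge0 ?addr_ge0 ?invr_ge0 ?sqr_ge0 ?expR_ge1Dx.
  have h3 : expR (e / n%:R) - 1 <= e / n%:R * expR e.
    apply: le_trans (expR_sub1_le _) _; first by rewrite divr_ge0.
    by rewrite ler_wpM2l ?divr_ge0 // ler_expR ler_piMr.
  have h4 : P - rho <= rho * (e / n%:R * expR e).
    apply: le_trans (_ : rho * (expR (e / n%:R) - 1) <= _); last by rewrite ler_pM2l.
    rewrite mulrBr mulr1 lerD2r; apply: le_trans h _.
    by rewrite ler_pM2l.
  apply: le_trans (ler_wpM2l (ltW nR) h4) _.
  by rewrite le_eqVlt; apply/orP; left; apply/eqP; rewrite /D; field; rewrite ?nn0 ?ln0.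
have Pr0 : 0 <= P - rho by rewrite subr_ge0.
have D1 : `|n%:R * (P - rho)| <= D by rewrite ger0_norm // mulr_ge0 // ltW.
have PM : P <= M.
  have : P - rho <= n%:R * (P - rho) by rewrite ler_peMl // ler1n.
  by rewrite /M; lra.
have P0 : 0 <= P by apply: le_trans P1; exact: ltW.
split.
  have -> : mean_tables alpha (theta n) n - n%:R * mean_const lambda alpha = lambda / alpha * (n%:R * (P - rho)).
    have mE := mean_tablesE alpha tn n; rewrite -/P in mE.
    have -> : mean_tables alpha (theta n) n = theta n * (P - 1) / alpha.
      by rewrite mulrBr mulr1 -mE; field.
    by rewrite /mean_const (negbTE an) -/rho; field.
  rewrite normrM ger0_norm ?divr_ge0 ?(ltW lambda0) //.
  by rewrite ler_wpM2l ?divr_ge0 // ltW.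
have /= [] := prod_sq alpha01 tn n; set Q := \prod_(_ < _) _ => Q0 Q1 Q2 Q3.
have vE : alpha ^+ 2 * var_tables alpha (theta n) n =
  theta n * (theta n + alpha) * (P ^+ 2 * Q) - alpha * theta n * P - theta n ^+ 2 * P ^+ 2.
  by rewrite var_tablesM // (prod_double alpha01 tn).
set v := var_tables _ _ _ in vE *.
have iE : (theta n)^-1 - (theta n + n%:R)^-1 = (theta n * (1 + lambda))^-1.
  by field; rewrite l1 ln0 nn0 //= gt_eqF //; exact: thetaDn_gt0.
rewrite iE in Q3.
have sE : n%:R * var_const lambda alpha =
  theta n / alpha * (rho ^+ 2 * (1 - alpha / (1 + lambda)) - rho).
  rewrite /var_const (negbTE an) -/rho.
  have -> : (1 + lambda^-1) `^ (2 * alpha) = rho ^+ 2.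
    by rewrite mulrC powRrM powR_mulrn // powR_ge0.
  by field; rewrite an l1.
have -> : v - n%:R * var_const lambda alpha =
  (lambda ^+ 2 * P ^+ 2 * (n%:R ^+ 2 * (Q - 1 + alpha ^+ 2 * (theta n * (1 + lambda))^-1))
   - lambda * alpha ^+ 2 / (1 + lambda) * (n%:R * (P - rho) * (P + rho))
   - alpha * lambda * (P ^+ 2 * (n%:R * (1 - Q)))
   + alpha * lambda * (n%:R * (P - rho) * (P + rho))
   - alpha * lambda * (n%:R * (P - rho))) / alpha ^+ 2.
  have -> : v = (alpha ^+ 2 * v) / alpha ^+ 2 by field.
  by rewrite vE sE; field; rewrite an l1 ln0 nn0.
rewrite normrM [X in _ * X]ger0_norm ?invr_ge0 ?sqr_ge0 //.
rewrite ler_wpM2r ?invr_ge0 ?sqr_ge0 // /c.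
have PP : 0 <= P + rho <= M + rho by rewrite addr_ge0 ?(ltW rho0) // lerD2r.
case/andP: PP => PP0 PP1.
have D2 : `|n%:R * (P - rho) * (P + rho)| <= D * (M + rho).
  by rewrite normrM [X in _ * X]ger0_norm // ler_pM.
have P2 : P ^+ 2 <= M ^+ 2 by rewrite lerXn2r // nnegrE.
have al0 : 0 <= alpha * lambda by rewrite mulr_ge0 // ltW.
have la0 : 0 <= lambda * alpha ^+ 2 / (1 + lambda).
  by rewrite divr_ge0 ?mulr_ge0 ?sqr_ge0 ?addr_ge0 // ltW.
apply: le_trans (ler_normB _ _) _; apply: lerD; last first.
  by rewrite normrM ger0_norm // ler_wpM2l.
apply: le_trans (ler_normD _ _) _; apply: lerD; last first.
  by rewrite normrM ger0_norm // ler_wpM2l.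
apply: le_trans (ler_normB _ _) _; apply: lerD; last first.
  have nQ : 0 <= n%:R * (1 - Q) by rewrite mulr_ge0 // subr_ge0.
  rewrite normrM (ger0_norm al0) ler_wpM2l // ger0_norm; last by rewrite mulr_ge0 ?sqr_ge0.
  apply: ler_pM => //; first by rewrite sqr_ge0.
  apply: le_trans (ler_wpM2l (ltW nR) Q2) _; rewrite en.
  by rewrite mulrC divfK // nn0.
apply: le_trans (ler_normB _ _) _; apply: lerD; last first.
  by rewrite normrM (ger0_norm la0) ler_wpM2l.
have lP0 : 0 <= lambda ^+ 2 * P ^+ 2 by apply: mulr_ge0; exact: sqr_ge0.
rewrite normrM (ger0_norm lP0); apply: ler_pM => //.
  by rewrite ler_wpM2l ?sqr_ge0.
rewrite normrM ger0_norm ?sqr_ge0 //.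
apply: le_trans (ler_wpM2l (sqr_ge0 _) Q3) _.
by rewrite le_eqVlt; apply/orP; left; apply/eqP; rewrite /e; field; rewrite ?nn0 ?ln0.
Qed.

End moment_asymptotics.

(** * The number of parts of an Ewens--Pitman partition *)

Section compositions.

(** The lists of k positive integers with sum n. *)
Fixpoint compositions k n : seq (seq nat) :=
  if k is k'.+1 then [seq m :: s | m <- iota 1 n, s <- compositions k' (n - m)%N]
  else if n == 0%N then [:: [::]] else [::].

Lemma mem_compositions k n s :
  (s \in compositions k n) = [&& size s == k, all (leq 1) s & sumn s == n].
Proof.
elim: k n s => [|k IH] n s /=.
  case: s => [|m s] /=; last by case: ifP.
  by rewrite eq_sym; case: ifP.
apply/allpairsPdep/idP => [[m [u [mn un ->]]] /=|].
  move: mn; rewrite mem_iota => /andP[m1 mn].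
  move: un; rewrite IH => /and3P[/eqP-> -> /eqP->].
  by rewrite eqxx m1 /=; apply/eqP; lia.
case: s => [//|m u] /= /and3P[/eqP[uk] /andP[m1 u1] /eqP mn].
exists m, u; split=> //; first by rewrite mem_iota; lia.
by rewrite IH uk eqxx u1 /=; apply/eqP; lia.
Qed.

Lemma compositions_uniq k n : uniq (compositions k n).
Proof.
elim: k n => [|k IH] n /=; first by case: ifP.
apply: allpairs_uniq_dep => [|m _|[m u] [m' u'] _ _ /= [-> ->]] //.
exact: iota_uniq.
Qed.

Definition all_compositions n : seq (seq nat) :=
  [seq s | k <- iota 0 n.+1, s <- compositions k n].

Lemma all_compositions_uniq n : uniq (all_compositions n).
Proof.
apply: allpairs_uniq_dep => [|k _|]; first exact: iota_uniq.
  exact: compositions_uniq.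
move=> [k u] [k' u'] /allpairsPdep[j [v [_ + [e1 e2]]]] /allpairsPdep[j' [v' [_ + [e1' e2']]]] /=.
subst; rewrite !mem_compositions => /and3P[/eqP<- _ _] /and3P[/eqP<- _ _] e.
by subst.
Qed.

Lemma mem_all_compositions n s :
  (s \in all_compositions n) = all (leq 1) s && (sumn s == n).
Proof.
apply/allpairsPdep/idP => [[k [u [_ + ->]]]|/andP[s1 sn]].
  by rewrite mem_compositions => /and3P[_ -> ->].
exists (size s), s; rewrite mem_compositions eqxx s1 sn; split=> //.
rewrite mem_iota /= add0n ltnS -(eqP sn).
by elim: s s1 {sn} => //= m s IH /andP[m1 /IH]; lia.
Qed.

End compositions.

Section weights.
Variables (R : realType) (alpha theta : R) (N : nat).
Hypothesis theta0 : 0 < theta.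

Definition block_weight (m : nat) : R :=
  if m is m'.+1 then rising (1 - alpha) m' 1 / m`!%:R else 0.

(** The generating function of the block weights, truncated at a degree beyond
    those of interest. *)
Definition block_poly : {poly R} := \poly_(i < N.+2) block_weight i.

Lemma block_weightS m : m.+1%:R * block_weight m.+1 = (m%:R - alpha) * block_weight m + (m == 0%N)%:R.
Proof.
case: m => [|m]; rewrite /block_weight.
  by rewrite mulr0 add0r mul1r /rising big_ord0 divr1.
rewrite addr0 {1}/rising big_ord_recr /= -/(rising (1 - alpha) m 1) mulr1.
rewrite (factS m.+1) natrM -!natr1.
have h : m.+1`!%:R != 0 :> R by rewrite pnatr_eq0 -lt0n fact_gt0.
have h2 : m%:R + 1 + 1 != 0 :> R by rewrite !natr1 pnatr_eq0.
by field; rewrite h h2.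
Qed.

Lemma compositions_coef k n : (n <= N.+1)%N ->
  \sum_(s <- compositions k n) \prod_(m <- s) block_weight m = (block_poly ^+ k)`_n.
Proof.
elim: k n => [|k IH] n nN.
  rewrite expr0 coef1 /=; case: eqP => _; last by rewrite big_nil.
  by rewrite big_seq1 big_nil.
rewrite big_allpairs_dep exprS coefM big_ord_recl /= coef_poly /= mul0r add0r.
rewrite -[iota 1 n]/(iota (1 + 0) n) iotaDl big_map -val_enum_ord big_map big_enum /=.
apply: eq_bigr => i _; rewrite /bump /= add1n coef_poly.
have -> : (i.+1 < N.+2)%N by have := ltn_ord i; lia.
rewrite -IH; last by lia.
by rewrite mulr_sumr; apply: eq_bigr => s _; rewrite big_cons.
Qed.

(** Modulo higher powers, W' = 1 + X W' - alpha W, so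
    (W^k)' = k W^(k - 1) + X (W^k)' - alpha k W^k; this compares the
    coefficients of X^n. *)
Lemma block_poly_rec k n : (n <= N)%N ->
  n.+1%:R * (block_poly ^+ k)`_n.+1 =
  (n%:R - alpha * k%:R) * (block_poly ^+ k)`_n + k%:R * (block_poly ^+ k.-1)`_n.
Proof.
move=> nN; set W := block_poly.
case: k => [|k]; first by rewrite expr0 !coef1; case: n nN => [|n] nN /=; ring.
have dW : (W ^+ k.+1)^`() = (W ^+ k * W^`()) *+ k.+1 by rewrite deriv_exp mulrC.
have dcoef m : m.+1%:R * (W ^+ k.+1)`_m.+1 = k.+1%:R * (W ^+ k * W^`())`_m.
  by rewrite !mulr_natl -coef_deriv dW coefMn.
have W'i i : (i <= N)%N -> W^`()`_i = ('X * W^`() - alpha *: W + 1)`_i.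
  have Wc j : (j <= N.+1)%N -> W`_j = block_weight j.
    by move=> jN; rewrite /W /block_poly coef_poly ltnS jN.
  move=> iN; rewrite !coefD coefN coefZ coefXM coef1 !coef_deriv.
  rewrite (Wc i.+1) // (Wc i) ?(leqW iN) // -[LHS]mulr_natl block_weightS mulrBl.
  congr (_ - _ + _); case: i iN => [|i] iN /=; first by rewrite mul0r.
  by rewrite Wc ?(leqW iN) // mulr_natl.
rewrite dcoef.
have -> : (W ^+ k * W^`())`_n = (W ^+ k * ('X * W^`() - alpha *: W + 1))`_n.
  rewrite !coefM; apply: eq_bigr => i _; rewrite W'i //.
  by have := ltn_ord i; lia.
have -> : W ^+ k * ('X * W^`() - alpha *: W + 1) =
  'X * (W ^+ k * W^`()) - alpha *: W ^+ k.+1 + W ^+ k.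
  by rewrite !mulrDr mulr1 mulrN -scalerAr -exprSr; congr (_ - _ + _); ring.
rewrite !coefD coefN coefZ coefXM.
case: n nN {W'i} => [|n] nN /=; first by ring.
by rewrite !mulrDr -dcoef; ring.
Qed.

(** The sum of the Ewens--Pitman weights over the compositions of n with k parts. *)
Definition parts_law n k : R :=
  rising theta k alpha / rising theta n 1 * (n`!%:R / k`!%:R) * (block_poly ^+ k)`_n.

Lemma risingS (x a : R) m : rising x m.+1 a = rising x m a * (x + m%:R * a).
Proof. by rewrite /rising big_ord_recr. Qed.

Lemma rising_gt0 m : 0 < rising theta m 1.
Proof.
by apply: prodr_gt0 => i _; rewrite mulr1; exact: thetaDn_gt0.
Qed.

Lemma block_poly_coef0 k n : (n < k)%N -> (block_poly ^+ k)`_n = 0.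
Proof.
elim: k n => [//|k IH] n nk; rewrite exprS coefM big1 // => -[i /= ltin] _.
case: i ltin => [|i] ltin; first by rewrite coef_poly mul0r.
by rewrite IH ?mulr0 //; lia.
Qed.

(** This is the forward equation of the chain of table counts. *)
Lemma parts_law_rec n k : (n <= N)%N ->
  parts_law n.+1 k.+1 = (1 - new_table alpha theta n k.+1%:R) * parts_law n k.+1
    + new_table alpha theta n k%:R * parts_law n k.
Proof.
move=> nN; have rn : rising theta n 1 != 0 by rewrite gt_eqF // rising_gt0.
have tn : theta + n%:R != 0 by rewrite gt_eqF // thetaDn_gt0.
have kf : k`!%:R != 0 :> R by rewrite pnatr_eq0 -lt0n fact_gt0.
have k1 : k%:R + 1 != 0 :> R by rewrite natr1 pnatr_eq0.
have H := block_poly_rec k.+1 nN; rewrite /= in H.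
set c := (block_poly ^+ k.+1)`_n in H *; set c' := (block_poly ^+ k)`_n in H *.
rewrite /parts_law -/c -/c' !risingS !factS !natrM mulr1.
set x := (block_poly ^+ k.+1)`_n.+1 in H *.
have -> : rising theta k alpha * (theta + k%:R * alpha) / (rising theta n 1 * (theta + n%:R)) *
    (n.+1%:R * n`!%:R / (k.+1%:R * k`!%:R)) * x =
    rising theta k alpha * (theta + k%:R * alpha) / (rising theta n 1 * (theta + n%:R)) *
    (n`!%:R / (k.+1%:R * k`!%:R)) * (n.+1%:R * x) by ring.
rewrite H /new_table -!natr1; field.
by rewrite rn tn kf k1.
Qed.

Lemma parts_law_rec0 n : (n <= N)%N ->
  parts_law n.+1 0 = (1 - new_table alpha theta n 0) * parts_law n 0.
Proof.
move=> nN; rewrite /parts_law !expr0 !coef1 /= mulr0.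
case: n nN => [|n] nN /=; last by rewrite !mulr0.
by rewrite /new_table mulr0 addr0 divff ?gt_eqF // subrr mul0r.
Qed.

Lemma parts_law_run n g : (n <= N.+1)%N ->
  run alpha theta 0 n g 0 = \sum_(k < n.+1) parts_law n k * g k.
Proof.
elim: n g => [|n IH] g nN.
  rewrite big_ord1 /= /parts_law /rising !big_ord0 expr0 coef1 /= !fact0.
  by rewrite !divr1 !mul1r.
rewrite runS_r IH; last by lia.
rewrite add0n [RHS]big_ord_recl /= /bump /=.
under [X in _ = _ + X]eq_bigr => i _ do rewrite add1n parts_law_rec // mulrDl.
rewrite big_split /= addrA.
have -> : parts_law n.+1 0 * g 0 + \sum_(i < n.+1) (1 - new_table alpha theta n i.+1%:R) * parts_law n i.+1 * g i.+1
  = \sum_(i < n.+2) (1 - new_table alpha theta n i%:R) * parts_law n i * g i.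
  rewrite [RHS]big_ord_recl /= parts_law_rec0 //; congr (_ + _).
rewrite [X in _ = X + _]big_ord_recr /=.
have -> : parts_law n n.+1 = 0 by rewrite /parts_law block_poly_coef0 // mulr0.
rewrite mulr0 mul0r addr0 -big_split /=.
by apply: eq_bigr => i _; rewrite /step; ring.
Qed.

Lemma parts_lawE n k : (n <= N.+1)%N ->
  \sum_(s <- compositions k n) ewens_pitman_pmf n alpha theta s = parts_law n k.
Proof.
move=> nN; rewrite /parts_law -compositions_coef // mulr_sumr big_seq [RHS]big_seq.
apply: eq_bigr => s; rewrite mem_compositions => /and3P[/eqP sk s1 _].
rewrite /ewens_pitman_pmf sk.
have -> : \prod_(m <- s) block_weight m =
   (\prod_(m <- s) rising (1 - alpha) m.-1 1) / (\prod_(m <- s) m`!%:R).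
  elim: s s1 {sk} => [|m s IH] /=; first by rewrite !big_nil divr1.
  move=> /andP[m1 /IH]; rewrite !big_cons => ->.
  by case: m m1 => [//|m] _; rewrite /block_weight /= invfM; ring.
by ring.
Qed.

End weights.

Section law.
Variables (R : realType) (alpha theta : R) (n : nat).
Variables (d : measure_display) (T : measurableType d) (P : probability T R).
Variables (Pi : {RV P >-> {set {set 'I_n}}}) (N : {RV P >-> seq nat}).
Hypothesis theta0 : 0 < theta.
Hypothesis EP : ewens_pitman alpha theta Pi N.

Lemma size_parts t : size (N t) = #|Pi t|.
Proof. by case: EP => _ /(_ t)/perm_size -> _; rewrite size_map -cardE. Qed.

Lemma parts_mem t : N t \in all_compositions n.
Proof.
case: EP => /(_ t) part /(_ t) pe _.
rewrite mem_all_compositions (perm_all _ pe) (perm_sumn pe); apply/andP; split.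
  apply/allP => m /mapP[B]; rewrite mem_enum => BP ->.
  rewrite card_gt0; apply: contraTneq BP => ->.
  by case/and3P: part.
rewrite sumnE big_map big_enum /=; case/and3P: part => /eqP cov_tables tr _.
by move/eqP: tr => ->; rewrite cov_tables cardsT card_ord.
Qed.

Lemma measurable_parts (L : pred (seq nat)) : measurable [set t | L (N t)].
Proof.
rewrite -[X in measurable X]setTI.
by apply: (measurable_funP N measurableT [set s | L s]).
Qed.

Lemma prob_parts_eq s : s \in all_compositions n ->
  P [set t | N t = s] = (ewens_pitman_pmf n alpha theta s)%:E.
Proof.
rewrite mem_all_compositions => /andP[s1 /eqP sn]; case: EP => _ _ /(_ s s1 sn) <-.
congr (P _); apply/seteqP; split => t /=; last by case.
by move=> Nt; rewrite -size_parts Nt.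
Qed.

Lemma prob_parts_in (L : seq (seq nat)) : uniq L -> {subset L <= all_compositions n} ->
  P [set t | N t \in L] = (\sum_(s <- L) ewens_pitman_pmf n alpha theta s)%:E.
Proof.
elim: L => [|s L IH] /=.
  by move=> _ _; rewrite big_nil (_ : [set t | _] = set0) ?measure0 //; apply/seteqP; split.
move=> /andP[sL uL] sub; rewrite big_cons EFinD -IH //; last first.
  by move=> u uL'; apply: sub; rewrite inE uL' orbT.
rewrite -prob_parts_eq; last by apply: sub; rewrite inE eqxx.
rewrite -measureU.
- congr (P _); apply/seteqP; split => t /=.
    by rewrite inE => /predU1P[->|]; [left|right].
  by rewrite inE => -[->|->]; rewrite ?eqxx ?orbT.
- rewrite (_ : [set t | N t = s] = [set t | N t == s]); first exact: (measurable_parts (pred1 s)).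
  by apply/seteqP; split => t /= /eqP.
- exact: (measurable_parts (mem L)).
- apply/seteqP; split => t //= [-> sL'].
  by rewrite sL' in sL.
Qed.

(** The event only depends on the list of part sizes, which is a composition of n;
    its probability is a finite sum of weights. *)
Lemma parts_run (A : pred nat) :
  P [set t | A #|Pi t|] = (run alpha theta 0 n (fun k => (A k)%:R) 0)%:E.
Proof.
have -> : [set t | A #|Pi t|] = [set t | N t \in [seq s <- all_compositions n | A (size s)]].
  apply/seteqP; split => t /=; rewrite mem_filter size_parts parts_mem andbT //.
rewrite prob_parts_in.
- rewrite (parts_law_run (N := n) alpha theta0) //; congr EFin.
  rewrite big_filter big_mkcond big_allpairs_dep -[iota 0 n.+1]val_enum_ord big_map big_enum /=.
  apply: eq_bigr => k _; rewrite -(parts_lawE alpha theta0 k (leqnSn n)) mulr_suml.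
  rewrite big_seq [RHS]big_seq; apply: eq_bigr => s; rewrite mem_compositions.
  by move=> /and3P[/eqP-> _ _]; case: (A k); rewrite ?mulr1 ?mulr0.
- by rewrite filter_uniq // all_compositions_uniq.
- by move=> s; rewrite mem_filter => /andP[].
Qed.

End law.

(** * Berry--Esseen bound and convergence in distribution *)

Section rate.
Variables (R : realType) (lambda alpha : R).
Hypotheses (lambda0 : 0 < lambda) (alpha01 : 0 <= alpha < 1).
Let s := sd_const lambda alpha.
Let s0 : 0 < s. Proof. by rewrite sqrtr_gt0 var_const_gt0. Qed.

Definition chain_cdf n x := run alpha (lambda * n%:R) 0 n
  (fun k => (lattice n (n%:R * mean_const lambda alpha) s k <= x)%R%:R) 0.

(** Both bounds follow from the same lattice estimate; for the first one the
    ramp has about n^(1/4) lattice steps. *)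
Lemma chain_cdf_rate : exists2 K : R, 0 <= K & forall n, (0 < n)%N -> forall x,
  `|chain_cdf n x - normal_cdf x| <= K / Num.sqrt (Num.sqrt n%:R) /\
  (alpha = 0 -> `|chain_cdf n x - normal_cdf x| <= K / Num.sqrt n%:R).
Proof.
have [c1 [c2 H]] := moments_bounded lambda0 alpha01.
have c10 : 0 <= c1 by apply: le_trans (H 1%N isT).1.
have c20 : 0 <= c2 by apply: le_trans (H 1%N isT).2.
have s2 : s ^+ 2 = var_const lambda alpha by rewrite sqr_sqrtr // ltW // var_const_gt0.
pose r := lambda^-1.
pose A := lattice_cst r s c1 c2 + c2 / s ^+ 2.
pose B := (1 + c2 / s ^+ 2) * spliced_cst r.
have s20 : 0 <= c2 / s ^+ 2 by rewrite divr_ge0 ?sqr_ge0.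
have m0 : 0 <= spliced_cst r.
  by rewrite /spliced_cst addr_ge0 ?mulr_ge0 ?sqr_ge0 ?addr_ge0 ?mulr_ge0 ?expR_ge0 // invr_ge0 ltW.
have B0 : 0 <= B by apply: mulr_ge0 => //; exact: addr_ge0.
have A0 : 0 <= A.
  have n1 : (0 < 1)%N by [].
  have t1 : 0 < lambda * 1%:R by rewrite mulr1.
  have r1 : 1%:R <= r * (lambda * 1%:R) by rewrite mulr1 mulVf // gt_eqF.
  have [Hm Hv] := H 1%N n1.
  have Hv1 : `|var_tables alpha (lambda * 1%:R) 1 - (s * Num.sqrt 1%:R) ^+ 2| <= c2.
    by rewrite exprMn s2 sqr_sqrtr // [var_const _ _ * _]mulrC.
  (* [lattice_cst] bounds an absolute value, so it is nonnegative. *)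
  have := lattice_bound alpha01 t1 r1 n1 s0 Hm Hv1 0.
  rewrite sqrtr1 divr1 => /(le_trans (normr_ge0 _)) ?.
  exact: addr_ge0.
have sV : 0 <= s^-1 by rewrite invr_ge0 ltW.
exists (A + B + 3 * s^-1); first by apply: addr_ge0; [exact: addr_ge0|exact: mulr_ge0].
move=> n n0 x; have nR : 0 < n%:R :> R by rewrite ltr0n.
set S := Num.sqrt n%:R; have S0 : 0 < S by rewrite sqrtr_gt0.
have S1 : 1 <= S by rewrite -[leLHS]sqrtr1 ler_sqrt // ler1n.
set q := Num.sqrt S; have q0 : 0 < q by rewrite sqrtr_gt0.
have q1 : 1 <= q by rewrite -[leLHS]sqrtr1 ler_sqrt // ltW.
have qS : q ^+ 2 = S by rewrite sqr_sqrtr // ltW.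
have th0 : 0 < lambda * n%:R by rewrite mulr_gt0.
have rn : n%:R <= r * (lambda * n%:R) by rewrite mulrA mulVf ?mul1r // gt_eqF.
have [Hm Hv] := H n n0.
have Hv' : `|var_tables alpha (lambda * n%:R) n - (s * Num.sqrt n%:R) ^+ 2| <= c2.
  by rewrite exprMn s2 sqr_sqrtr // [var_const _ _ * _]mulrC.
have SV : S^-1 <= q^-1 by rewrite lef_pV2 ?posrE // -qS expr2 ler_peMr // ltW.
split; last first.
  move=> a0; apply: le_trans (kolmogorov_alpha0 alpha01 th0 rn n0 s0 Hm Hv' a0 x) _.
  rewrite -/S -/A invfM [leRHS]mulrDl [(A + B) / S]mulrDl -addrA lerD2l.
  rewrite -[leLHS]add0r mulrA lerD ?divr_ge0 ?(ltW S0) //.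
  by rewrite ler_wpM2r ?invr_ge0 ?(ltW S0) // ler_wpM2r // ler_nat.
have L0 : (0 < (Num.truncn q).+1)%N by [].
apply: le_trans (kolmogorov_smooth alpha01 th0 rn n0 s0 Hm Hv' x L0) _.
rewrite -/S -/A.
have Lq : q <= (Num.truncn q).+1%:R by apply: ltW; exact: truncnS_gt.
have Lq2 : (Num.truncn q).+1%:R <= 2 * q.
  by rewrite -natr1 mulr_natl mulr2n lerD // truncn_le // ltW.
set L : R := (Num.truncn q).+1%:R in Lq Lq2 *.
have L1 : 0 < L by apply: lt_le_trans Lq.
have T1 : A / S <= A / q by rewrite ler_wpM2l.
have T2 : L * (s * S)^-1 <= 2 * s^-1 / q.
  apply: le_trans (ler_wpM2r _ Lq2) _; first by rewrite invr_ge0 mulr_ge0 // ltW.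
  by rewrite -qS le_eqVlt; apply/orP; left; apply/eqP; field; rewrite !gt_eqF.
have T3 : (1 + c2 / s ^+ 2) * (spliced_cst r / L) <= B / q.
  by rewrite /B -mulrA ler_wpM2l ?addr_ge0 // ler_wpM2l // lef_pV2.
have T4 : (s * S)^-1 <= s^-1 / q by rewrite invfM ler_wpM2l.
have -> : (A + B + 3 * s^-1) / q = A / q + 2 * s^-1 / q + B / q + s^-1 / q by ring.
by rewrite !lerD.
Qed.

End rate.

Lemma latticeE (R : realType) (n : nat) (m s : R) k : (0 < n)%N ->
  Num.sqrt n%:R / s * (k%:R / n%:R - m) = lattice n (n%:R * m) s k.
Proof.
move=> n0; rewrite /lattice; have S0 : 0 < Num.sqrt (n%:R : R) by rewrite sqrtr_gt0 ltr0n.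
have nE : n%:R = Num.sqrt (n%:R : R) ^+ 2 by rewrite sqr_sqrtr.
have -> : k%:R - n%:R * m = n%:R * (k%:R / n%:R - m).
  by rewrite mulrBr mulrCA divff ?mulr1 // pnatr_eq0; case: n n0 {S0 nE}.
rewrite [X in _ = X * _ / _]nE invfM; move: (s^-1) => t; field.
by rewrite !gt_eqF ?ltr0n.
Qed.

Theorem theorem2 (R : realType) :
  exists (C1 : R -> R -> R -> R) (C2 : R -> R),
  forall (lambda alpha : R), 0 < lambda -> 0 <= alpha < 1 ->
  forall (d : nat -> measure_display) (T : forall n, measurableType (d n))
    (P : forall n, probability (T n) R)
    (Pi : forall n, {RV (P n) >-> {set {set 'I_n}}})
    (N : forall n, {RV (P n) >-> seq nat}),
  (forall n : nat, (0 < n)%N ->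
     ewens_pitman alpha (lambda * n%:R) (Pi n) (N n)) ->
  let X n : {RV (P n) >-> R} := standardized_parts lambda alpha (Pi n) in
  let Phi x := normal_prob (0 : R) 1 `]-oo, x]%classic in
  (forall eps : R, 0 < eps < 1 -> forall n : nat, (0 < n)%N ->
     (ereal_sup [set `|cdf (X n) x - Phi x| | x in [set: R]] <=
      (if alpha == 0 then C2 lambda * n%:R `^ (- (1 / 2))
       else C1 lambda alpha eps * n%:R `^ (- (1 / 5) + 2 * eps / 5))%:E)%E) /\
  cvg_in_distribution X (normal_prob (0 : R) 1).
Proof.
(* The constants depend on lambda and alpha only, so they are chosen before the
   probability spaces. *)
have [K HK] : exists K : R * R -> R, forall la : R * R, 0 < la.1 -> 0 <= la.2 < 1 ->
    0 <= K la /\ forall n, (0 < n)%N -> forall x,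
      `|chain_cdf la.1 la.2 n x - normal_cdf x| <= K la / Num.sqrt (Num.sqrt n%:R) /\
      (la.2 = 0 -> `|chain_cdf la.1 la.2 n x - normal_cdf x| <= K la / Num.sqrt n%:R).
  suff /choice[K HK] : forall la : R * R, exists k : R, 0 < la.1 -> 0 <= la.2 < 1 ->
    0 <= k /\ forall n, (0 < n)%N -> forall x,
      `|chain_cdf la.1 la.2 n x - normal_cdf x| <= k / Num.sqrt (Num.sqrt n%:R) /\
      (la.2 = 0 -> `|chain_cdf la.1 la.2 n x - normal_cdf x| <= k / Num.sqrt n%:R).
    by exists K.
  move=> [l a] /=; case: (pselect (0 < l /\ 0 <= a < 1)) => [[l0 a01]|h].
    by have [k k0 hk] := chain_cdf_rate l0 a01; exists k.
  by exists 0 => l0 a01; case: h.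
exists (fun l a _ => K (l, a)), (fun l => K (l, 0)) => lambda alpha l0 a01 d T P Pi N EP X Phi.
have [K0 HKx] := HK (lambda, alpha) l0 a01.
set k := K (lambda, alpha) in K0 HKx.
have cdfE n x : (0 < n)%N -> cdf (X n) x = (chain_cdf lambda alpha n x)%:E.
  move=> n0; have th0 : 0 < lambda * n%:R by rewrite mulr_gt0 // ltr0n.
  rewrite /chain_cdf -(parts_run th0 (EP n n0)
    (fun k => lattice n (n%:R * mean_const lambda alpha) (sd_const lambda alpha) k <= x)).
  congr (P n _); apply/seteqP; split => t /=;
    by rewrite in_itv /= /standardized_parts latticeE.
have dist n x : (0 < n)%N -> (`|cdf (X n) x - Phi x| = `|chain_cdf lambda alpha n x - normal_cdf x|%:E)%E.
  by move=> n0; rewrite cdfE // /Phi normal_cdfE.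
split.
  move=> eps /andP[e0 e1] n n0; apply: ge_ereal_sup => _ [x _ <-].
  rewrite dist // lee_fin; have [H1 H2] := HKx n n0 x.
  have n1 : 1 <= n%:R :> R by rewrite ler1n.
  case: eqVneq => [a0|an].
    rewrite powRN div1r powR12_sqrt //.
    by move: (H2 a0); rewrite /k a0.
  apply: le_trans H1 _; rewrite ler_wpM2l //.
  rewrite -!powR12_sqrt ?sqrtr_ge0 // -powRrM -powRN ler_powR //.
  by lra.
move=> x _; suff : cdf (X n) x @[n --> \oo] --> (normal_cdf x)%:E by rewrite -normal_cdfE.
apply/fine_cvgP; split.
  by apply: nearW => n; rewrite fin_num_measure.
apply/cvgrPdist_le => e ep; near=> n.
have n0 : (0 < n)%N by near: n; exact: nbhs_infty_gt.
rewrite /= cdfE //= distrC; have [+ _] := HKx n n0 x; move=> /le_trans; apply.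
have nM : ((k / e) ^+ 2) ^+ 2 <= n%:R :> R by near: n; exact: nbhs_infty_ger.
have q0 : 0 < Num.sqrt (Num.sqrt (n%:R : R)) by rewrite !sqrtr_gt0 ltr0n.
rewrite ler_pdivrMr // mulrC -ler_pdivrMr //.
have ke : 0 <= k / e by rewrite divr_ge0 // ltW.
have -> : k / e = Num.sqrt (Num.sqrt (((k / e) ^+ 2) ^+ 2)).
  by rewrite sqrtr_sqr ger0_norm ?sqr_ge0 // sqrtr_sqr ger0_norm.
by rewrite !ler_sqrt ?sqrtr_ge0.
Unshelve. all: by end_near.
Qed.
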